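(* Let $G$ be a semisimple Lie group of compact type and $LG$ its loop group. Let $\Omega=\Omega^{(1/2)}$ be the curvature of the Levi-Civita connection $\nabla=d+\theta^{(1/2)}$ for the left-invariant $H^{1/2}$ metric on $LG$. Then the weighted first Chern form $\mathrm{tr}^Q(\Omega)\in\Omega^2(LG,\mathbb{C})$ is closed.
   Context: $LG$ is the group of loops $S^1\to G$ (take smooth loops), with Lie algebra $L\mathfrak{g}=C^\infty(S^1,\mathfrak{g})$, $\mathfrak{g}=\mathrm{Lie}(G)$; $TLG$ is trivialized by left translation. Let $(\cdot,\cdot)$ be minus the Killing form on $\mathfrak{g}$ and $\langle X,Y\rangle_0=\int_{S^1}(X,Y)\,d\theta$. Let $\Delta$ be the (non-negative) Laplacian on functions on $S^1$ and $Q_0=\Delta\otimes 1_{\mathfrak{g}}$, acting on $L\mathfrak{g}$; when powers are taken, $Q_0$ is replaced by $Q_0+P$, with $P$ the orthogonal projection onto $\ker Q_0$. The left-invariant $H^s$ metric on $LG$ is given on $L\mathfrak{g}$ by $\langle X,Y\rangle^s=\langle Q_0^{s/2}X,Q_0^{s/2}Y\rangle_0$. Its Levi-Civita connection is left-invariant, $\nabla^s=d+\theta^s$ in the left trivialization, where $\theta^s$ is induced by $$\theta_0^s(U)=\tfrac12\left(\mathrm{ad}_U+Q_0^{-s}\,\mathrm{ad}_U\,Q_0^s-Q_0^{-s}\,\mathrm{ad}_{Q_0^sU}\right),\qquad U\in L\mathfrak{g}.$$ Here $\mathrm{ad}_U$ is the pointwise bracket, a multiplication operator. The curvature is the left-invariant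 two-form with values in classical pseudodifferential operators given by $\Omega^{s}(U,V)=[\theta_0^s(U),\theta_0^s(V)]-\theta_0^s([U,V])$. The weight $Q$ is the left-invariant family $Q_\gamma=L_\gamma Q_0L_\gamma^{-1}$, $\gamma\in LG$, with $L_\gamma$ left translation. The weighted trace $\mathrm{tr}^Q(A)$ is the finite part, i.e. the coefficient of $\varepsilon^0$, in the asymptotic expansion of $\mathrm{Tr}(Ae^{-\varepsilon Q})$ as $\varepsilon\to0^+$ (operator trace on $L^2$ sections, after complexification), applied to the operator coefficients of $\Omega$. *)

(* Defs.v *)
From HB Require Import structures.
From mathcomp Require Import all_boot all_order all_algebra.
From mathcomp Require Import complex ring.
From mathcomp Require Import all_classical all_reals all_analysis.

Set Implicit Arguments.
Unset Strict Implicit.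
Unset Printing Implicit Defensive.

Import Order.TTheory GRing.Theory Num.Theory.
Import numFieldNormedType.Exports.

Local Open Scope classical_set_scope.
Local Open Scope ring_scope.
Local Open Scope complex_scope.

(** * Smooth maps and Lie groups *)

(* Only used for finite-dimensional V, where continuity of all iterated
   directional derivatives is the usual C^k condition; D is always open. *)
Fixpoint Ck (R : realType) (V W : normedModType R) (k : nat)
    (D : set V) (f : V -> W) : Prop :=
  (forall x, D x -> {for x, continuous f}) /\
  if k is k'.+1 then
    forall v, (forall x, D x -> derivable f x v) /\ Ck k' D ('D_v f)
  else True.

Definition smooth_on (R : realType) (V W : normedModType R)
    (D : set V) (f : V -> W) : Prop :=
  forall k, Ck k D f.

Record chart (R : realType) (T : topologicalType) (n : nat) := Chart {
  cdom : set T;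
  cmap : T -> 'rV[R]_n;
  cinv : 'rV[R]_n -> T;
  cdom_open : open cdom;
  cimg_open : open (cmap @` cdom);
  cmapK : forall x, cdom x -> cinv (cmap x) = x;
  cmap_continuous : forall x, cdom x -> {for x, continuous cmap};
  cinv_continuous : forall y, (cmap @` cdom) y -> {for y, continuous cinv}
}.

#[short(type="topGroupType")]
HB.structure Definition TopGroup := {G of Topological G & Group G}.

Record lieGroup (R : realType) := LieGroup {
  lie_group :> topGroupType;
  lie_dim : nat;
  lie_hausdorff : hausdorff_space lie_group;
  lie_second_countable : @second_countable lie_group;
  lie_atlas : set (chart R lie_group lie_dim);
  lie_cover : forall x, exists2 a, lie_atlas a & cdom a x;
  lie_compat : forall a b, lie_atlas a -> lie_atlas b ->
    smooth_on (cmap a @` (cdom a `&` cdom b)) (cmap b \o cinv a);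
  lie_mul_continuous :
    continuous (fun p : lie_group * lie_group => (p.1 * p.2)%g);
  lie_mul_smooth : forall a b c, lie_atlas a -> lie_atlas b -> lie_atlas c ->
    smooth_on
      [set p : 'rV[R]_lie_dim * 'rV[R]_lie_dim |
        [/\ (cmap a @` cdom a) p.1, (cmap b @` cdom b) p.2
          & cdom c (cinv a p.1 * cinv b p.2)%g]]
      (fun p => cmap c (cinv a p.1 * cinv b p.2)%g);
  lie_inv_continuous : continuous (fun x : lie_group => x^-1%g);
  lie_inv_smooth : forall a b, lie_atlas a -> lie_atlas b ->
    smooth_on
      [set y : 'rV[R]_lie_dim | (cmap a @` cdom a) y /\ cdom b (cinv a y)^-1%g]
      (fun y => cmap b (cinv a y)^-1%g)
}.

Section LieAlgebra.
Variables (R : realType) (G : lieGroup R).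

Definition smooth_fun (f : G -> R) : Prop :=
  forall a, lie_atlas a -> smooth_on (cmap a @` cdom a) (f \o cinv a).

Definition smooth_into (V : normedModType R) (c : V -> G) : Prop :=
  continuous c /\
  forall a, lie_atlas a -> smooth_on (c @^-1` cdom a) (cmap a \o c).

(* Vector fields are derivations of C^oo(G); the values of such an operator
   on non-smooth functions are irrelevant. *)
Definition derivation := (G -> R) -> G -> R.

Record left_invariant_vf (X : derivation) : Prop := LeftInvariantVF {
  livf_smooth : forall f, smooth_fun f -> smooth_fun (X f);
  livf_linear : forall a f g, smooth_fun f -> smooth_fun g ->
    X (fun p => a * f p + g p) = (fun p => a * X f p + X g p);
  livf_leibniz : forall f g, smooth_fun f -> smooth_fun g ->
    X (fun p => f p * g p) = (fun p => f p * X g p + X f p * g p);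
  livf_invariant : forall h f, smooth_fun f ->
    X (fun p => f (h * p)%g) = (fun p => X f (h * p)%g)
}.

Local Notation n := (lie_dim G).

Implicit Types E : 'I_n -> derivation.

Definition vf E (x : 'rV[R]_n) : derivation :=
  fun f p => \sum_i x ord0 i * E i f p.

(* E is a basis of the Lie algebra of left-invariant vector fields; from here
   on Lie(G) is identified with 'rV[R]_n through such a basis. *)
Definition lie_basis E : Prop :=
  (forall i, left_invariant_vf (E i)) /\
  (forall X, left_invariant_vf X ->
    exists! x : 'rV[R]_n, forall f, smooth_fun f -> X f = vf E x f).

Definition coords E (X : derivation) : 'rV[R]_n :=
  xget 0 [set x | forall f, smooth_fun f -> X f = vf E x f].

Definition br E (x y : 'rV[R]_n) : 'rV[R]_n :=
  coords E (fun f p => vf E x (vf E y f) p - vf E y (vf E x f) p).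

Definition killing E (x y : 'rV[R]_n) : R :=
  \tr (lin1_mx (br E x) *m lin1_mx (br E y)).

(* The row space of A ranges over all linear subspaces of Lie(G). *)
Definition semisimple E : Prop :=
  forall A : 'M[R]_n,
    (forall x y : 'rV[R]_n, (y <= A)%MS -> (br E x y <= A)%MS) ->
    (forall x y : 'rV[R]_n, (x <= A)%MS -> (y <= A)%MS -> br E x y = 0) ->
    A = 0.

Definition compact_type E : Prop :=
  forall x : 'rV[R]_n, x != 0 -> killing E x x < 0.

Definition one_parameter E (x : 'rV[R]_n) (c : R -> G) : Prop :=
  [/\ smooth_into c, forall s t, c (s + t) = (c s * c t)%g
    & forall f, smooth_fun f -> is_derive (0 : R) (1 : R) (f \o c) (vf E x f 1%g)].

Definition lie_exp E (x : 'rV[R]_n) : G :=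
  xget 1%g [set g | exists2 c, one_parameter E x c & c 1 = g].

End LieAlgebra.

(** * Loops; S^1 is R / 2 pi Z *)

Section Loops.
Variables (R : realType) (G : lieGroup R).
Local Notation n := (lie_dim G).

Definition periodic (T : Type) (f : R -> T) : Prop :=
  forall t, f (t + 2 * pi) = f t.

Definition LG (g : R -> G) : Prop := smooth_into g /\ periodic g.

Definition Lg (X : R -> 'rV[R]_n) : Prop := smooth_on setT X /\ periodic X.

Definition smooth_curve_LG (g : R -> R -> G) : Prop :=
  (forall t, LG (g t)) /\ smooth_into (fun p : R * R => g p.1 p.2).

Definition smooth_curve_Lg (X : R -> R -> 'rV[R]_n) : Prop :=
  (forall t, Lg (X t)) /\ smooth_on setT (fun p : R * R => X p.1 p.2).

(** * Differential forms on LG, in the left trivialization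
    TLG = LG x Lg: [w g X Y] is the value at the tangent vectors gX, gY. *)

Definition form2 := (R -> G) -> (R -> 'rV[R]_n) -> (R -> 'rV[R]_n) -> R[i].

(* Smoothness on the Frechet manifold LG x Lg x Lg is tested on smooth
   curves. *)
Definition is_form2 (w : form2) : Prop :=
  [/\ (forall g (a : R) X Y Z, LG g -> Lg X -> Lg Y -> Lg Z ->
         w g (fun t => a *: X t + Y t) Z = a%:C * w g X Z + w g Y Z),
      (forall g X Y, LG g -> Lg X -> Lg Y -> w g X Y = - w g Y X) &
      (forall g X Y, smooth_curve_LG g -> smooth_curve_Lg X ->
         smooth_curve_Lg Y ->
         smooth_on setT (fun t : R => complex.Re (w (g t) (X t) (Y t))) /\
         smooth_on setT (fun t : R => complex.Im (w (g t) (X t) (Y t))))].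

(* Derivative at g of F : LG -> C along the left-invariant vector field X,
   whose flow is g |-> g exp(tX). *)
Definition dLG (E : 'I_n -> derivation G) (F : (R -> G) -> R[i])
    (g : R -> G) (X : R -> 'rV[R]_n) : R[i] :=
  let c (t : R) : R -> G := fun th => (g th * lie_exp E (t *: X th))%g in
  derive1 (fun t : R => complex.Re (F (c t))) 0 +i*
  derive1 (fun t : R => complex.Im (F (c t))) 0.

(* dw evaluated on the left-invariant vector fields X, Y, Z. *)
Definition dform2 (E : 'I_n -> derivation G) (w : form2)
    (g : R -> G) (X Y Z : R -> 'rV[R]_n) : R[i] :=
  let lbr (A B : R -> 'rV[R]_n) := fun t => br E (A t) (B t) in
  dLG E (fun h => w h Y Z) g X - dLG E (fun h => w h X Z) g Y
  + dLG E (fun h => w h X Y) g Z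
  - w g (lbr X Y) Z + w g (lbr X Z) Y - w g (lbr Y Z) X.

Definition closed_form2 (E : 'I_n -> derivation G) (w : form2) : Prop :=
  forall g X Y Z, LG g -> Lg X -> Lg Y -> Lg Z -> dform2 E w g X Y Z = 0.

End Loops.

Lemma derive1_trig (R : realType) (k a b : R) :
  derive1 (fun t : R => a * cos (k * t) + b * sin (k * t)) =
  (fun t => (k * b) * cos (k * t) + (- (k * a)) * sin (k * t)).
Proof.
apply/funext => t; rewrite derive1E.
have -> : (fun t : R => a * cos (k * t) + b * sin (k * t)) =
  a *: (cos \o ( *%R k)) + b *: (sin \o ( *%R k)) by apply/funext.
have hk : is_derive t 1 ( *%R k) k.
  by have := is_deriveZ k (is_derive_id t (1:R)); rewrite /GRing.scale /= mulr1.
have h1 : is_derive t 1 (cos \o ( *%R k)) (k * - sin (k * t)).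
  have := @is_derive1_comp R cos ( *%R k) t _ _ (is_derive_cos _) hk; by rewrite mulrC.
have h2 : is_derive t 1 (sin \o ( *%R k)) (k * cos (k * t)).
  have := @is_derive1_comp R sin ( *%R k) t _ _ (is_derive_sin _) hk; by rewrite mulrC.
rewrite derive_val /GRing.scale /=; ring.
Qed.

(** * Operators on complexified loops C^oo(S^1, C^n) *)

Section Operators.
Variables (R : realType) (n : nat).

Definition cloop := R -> 'rV[R[i]]_n.
Definition operator := cloop -> cloop.

Definition clim (u : nat -> R[i]) : R[i] :=
  lim ((fun N => complex.Re (u N)) @ \oo) +i*
  lim ((fun N => complex.Im (u N)) @ \oo).

Definition cint (f : R -> R[i]) : R[i] :=
  (\int[lebesgue_measure]_(t in `[0%R, (2 * pi)%R]) complex.Re (f t)) +i*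
  (\int[lebesgue_measure]_(t in `[0%R, (2 * pi)%R]) complex.Im (f t)).

Definition expi (k : int) (t : R) : R[i] :=
  cos (k%:~R * t) +i* sin (k%:~R * t).

Definition mode (k : int) (x : 'rV[R[i]]_n) : cloop :=
  fun t => expi k t *: x.

Definition fcoef (X : cloop) (k : int) : 'rV[R[i]]_n :=
  \row_j ((2 * pi)^-1%:C * cint (fun t => expi (- k) t * X t ord0 j)).

(* Sum over the integers k with `|k| <= N. *)
Definition zsum (V : nmodType) (N : nat) (a : int -> V) : V :=
  \sum_(i < N.*2.+1) a (i%:Z - N%:Z).

Definition Q0 : operator := fun X t => \row_j
  - (derive1n 2 (fun s : R => complex.Re (X s ord0 j)) t +i*
     derive1n 2 (fun s : R => complex.Im (X s ord0 j)) t).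

Lemma Q0_mode (k : int) (x : 'rV[R[i]]_n) :
  Q0 (mode k x) = mode k ((k%:~R ^+ 2)%:C *: x).
Proof.
apply/funext => t; apply/rowP => j; rewrite !mxE.
case E : (x ord0 j) => [a b]; set c : R := k%:~R.
have -> : (fun s => complex.Re (mode k x s ord0 j)) =
  (fun s => a * cos (c * s) + (- b) * sin (c * s)).
  by apply/funext => s; rewrite !mxE E /=; ring.
have -> : (fun s => complex.Im (mode k x s ord0 j)) =
  (fun s => b * cos (c * s) + a * sin (c * s)).
  by apply/funext => s; rewrite !mxE E /=; ring.
rewrite /derive1n /= !derive1_trig /expi -/c; apply/eqP.
by rewrite eq_complex /=; apply/andP; split; apply/eqP; ring.
Qed.

(* ker Q0 consists of the constant loops. *)
Definition P0 : operator := fun X _ => fcoef X 0.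

Definition Q0P : operator := fun X t => Q0 X t + P0 X t.

(* Functional calculus phi(Q) for Q diagonal in the Fourier modes, as are Q0
   and Q0P: Q acts on exp(ik.) (x) C^n as the scalar [eigenval Q k], which by
   [Q0_mode] is k^2 for Q0 (and 1 instead of 0 at k = 0 for Q0P). *)
Definition eigenval (Q : operator) (k : int) : R :=
  xget 0 [set l : R | forall x, Q (mode k x) = mode k (l%:C *: x)].

Definition fcalc (phi : R -> R) (Q : operator) : operator := fun X t => \row_j
  clim (fun N => zsum N (fun k =>
    (phi (eigenval Q k))%:C * mode k (fcoef X k) t ord0 j)).

Definition Q0pow (s : R) : operator := fcalc (fun l => l `^ s) Q0P.

Definition heat (Q : operator) (eps : R) : operator :=
  fcalc (fun l => expR (- eps * l)) Q.

(* Diagonal entries of T in the basis exp(ik.) (x) e_j of L^2(S^1, C^n).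
   Their sum is the operator trace whenever T is trace class, as is every
   A e^{-eps Q} with A pseudodifferential. *)
Definition diag_entry (T : operator) (k : int) (j : 'I_n) : R[i] :=
  fcoef (T (mode k (delta_mx ord0 j))) k ord0 j.

Definition has_trace (T : operator) (z : R[i]) : Prop :=
  [/\ (exists M : R[i], forall N,
         zsum N (fun k => \sum_j `|diag_entry T k j|) <= M),
      (fun N => complex.Re (zsum N (fun k => \sum_j diag_entry T k j))) @ \oo
         --> complex.Re z &
      (fun N => complex.Im (zsum N (fun k => \sum_j diag_entry T k j))) @ \oo
         --> complex.Im z].

(* z is the constant term of the expansion of f at 0+: what remains once the
   terms in eps^(-p.1), p.1 > 0, and in log eps are subtracted tends to z.
   The other terms of the heat expansion, eps^a and eps^k log eps with
   a > 0 and k >= 1, tend to 0. *)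
Definition finite_part (f : R -> R[i]) (z : R[i]) : Prop :=
  exists (s : seq (R * R[i])) (b : R[i]), all (fun p => 0 < p.1) s /\
  let rem eps := f eps - \sum_(p <- s) (eps `^ (- p.1))%:C * p.2
                 - (ln eps)%:C * b in
  (fun eps => complex.Re (rem eps)) @ 0^'+ --> complex.Re z /\
  (fun eps => complex.Im (rem eps)) @ 0^'+ --> complex.Im z.

Definition is_wtrace (Q A : operator) (z : R[i]) : Prop :=
  exists f : R -> R[i],
    (forall eps, 0 < eps -> has_trace (A \o heat Q eps) (f eps)) /\
    finite_part f z.

Definition wtrace (Q A : operator) : R[i] := xget 0 (is_wtrace Q A).

End Operators.

(** * The H^s connection on LG, its curvature and the first Chern form *)

Section Chern.
Variables (R : realType) (G : lieGroup R) (E : 'I_(lie_dim G) -> derivation G).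
Local Notation n := (lie_dim G).

(* Complex bilinear extension of the bracket. *)
Definition brC (x y : 'rV[R[i]]_n) : 'rV[R[i]]_n :=
  \sum_i \sum_j (x ord0 i * y ord0 j) *:
    map_mx (real_complex R) (br E (delta_mx ord0 i) (delta_mx ord0 j)).

Definition ad (U : cloop R n) : operator R n := fun X t => brC (U t) (X t).

(* Levi-Civita connection form, in the left trivialization, of the H^s metric
   <X, Y>^s = <Q0^(s/2) X, Q0^(s/2) Y>_0, as given by the Koszul formula. *)
Definition theta0 (s : R) (U : cloop R n) : operator R n := fun X t =>
  2^-1 *: (ad U X t + Q0pow (- s) (ad U (Q0pow s X)) t
           - Q0pow (- s) (ad (Q0pow s U) X) t).

Definition complexify (U : R -> 'rV[R]_n) : cloop R n :=
  fun t => map_mx (real_complex R) (U t).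

(* Curvature dtheta + theta ^ theta: a left-invariant operator-valued two-form, hence independent of g in the left
   trivialization. *)
Definition Omega (s : R) (g : R -> G) (U V : R -> 'rV[R]_n) : operator R n :=
  let U' := complexify U in let V' := complexify V in
  fun X t => theta0 s U' (theta0 s V' X) t - theta0 s V' (theta0 s U' X) t
             - theta0 s (ad U' V') X t.

(* The operator L_g Q0 L_g^-1 on T_g LG; in the left trivialization
   L_g : Lg -> T_g LG is the identity of Lg. *)
Definition weight (g : R -> G) : operator R n := @Q0 R n.

Definition chern1 (s : R) : form2 G :=
  fun g U V => wtrace (weight g) (Omega s g U V).

End Chern.

(* Main.v *)
(** The weighted trace of the curvature vanishes identically: the operators
    [theta0 U] are real, so they commute with complex conjugation, and they
    are skew for the H^(1/2) metric, so the diagonal entries of [Omega]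
    cancel between the frequencies [k] and [-k], which have the same weight in
    [exp (- eps Q)].

    Concretely, write [lam k] for the eigenvalue [|k|] of Q0^(1/2) (1 at
    [k = 0]) and [A i] for the matrix of [ad e_i].  The trace of the k-th
    diagonal block of [theta0 U \o theta0 V] is a combination of
    [\tr (A i * A l)] with coefficients [scurv k u_l v_i], and
    [scurv (- k) u v = scurv k v u].  That identity follows from the
    self-adjointness of multipliers on rapidly decreasing Fourier
    coefficients and from the invariance of absolutely convergent series under
    index shifts; Fourier inversion is not needed.  The term
    [theta0 [U, V]] has trace zero since [\tr (ad [x, y]) = 0]. *)

Require Import Defs.
From mathcomp Require Import all_boot all_order all_algebra.
From mathcomp Require Import complex ring lra zify.
From mathcomp Require Import all_classical all_reals all_analysis.

Set Implicit Arguments.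
Unset Strict Implicit.
Unset Printing Implicit Defensive.

Import Order.TTheory GRing.Theory Num.Theory.
Import numFieldNormedType.Exports.

Local Open Scope classical_set_scope.
Local Open Scope ring_scope.
Local Open Scope complex_scope.

(** * Complex numbers and averages over the circle *)

(** Write L for Q0^(1/2). Twice the bilinear pairing of [stheta u f] with L g is the mean of u f (L
    g) + u (L f) g - (L u) f g, which does not change when f and g are exchanged; the sign in
    skewness comes from [ad]. Moving both factors of [stheta u (stheta v e_k)] across this pairing,
    in which e_k is dual to e_(-k), turns the k-th diagonal entry into the (-k)-th one with u and v
    exchanged. The obstacle is that a function produced by a multiplier is known through its series,
    so the symmetry has to be carried out on Fourier coefficients and pairings, inside a class of
    functions where every series is dominated by one fixed summable weight. The weighted trace is a
    value picked by choice. That it equals 0 takes two further facts: existence, where polynomial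
    growth of the diagonal blocks is beaten by the Gaussian weight, and uniqueness, since 0 might a
    priori have another finite part modulo negative powers and a logarithm. *)

Section ComplexModulus.
Variable R : realType.
Implicit Types x y z : R[i].

(** The norm of [R[i]] takes its values in [R[i]]; a real-valued modulus can be compared with real
    series and limits. *)
Definition cabs (z : R[i]) : R := Normc.normc z.

Lemma cabsE z : `|z| = (cabs z)%:C.
Proof. by case: z. Qed.

Lemma cabs_ge0 z : 0 <= cabs z.
Proof. by case: z => a b; exact: sqrtr_ge0. Qed.

Lemma cabs0 : cabs 0 = 0.
Proof. exact: Normc.normc0. Qed.

Lemma cabsM x y : cabs (x * y) = cabs x * cabs y.
Proof. exact: Normc.normcM. Qed.

Lemma cabsD x y : cabs (x + y) <= cabs x + cabs y.
Proof. exact: le_normcD. Qed.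

Lemma cabsN x : cabs (- x) = cabs x.
Proof. exact: normcN. Qed.

Lemma cabsB x y : cabs (x - y) <= cabs x + cabs y.
Proof. by rewrite -(cabsN y) cabsD. Qed.

Lemma cabs_real (r : R) : cabs r%:C = `|r|.
Proof. by rewrite /cabs /= expr0n /= addr0 sqrtr_sqr. Qed.

Lemma cabs_sum (I : Type) (s : seq I) (P : pred I) (F : I -> R[i]) :
  cabs (\sum_(i <- s | P i) F i) <= \sum_(i <- s | P i) cabs (F i).
Proof.
elim/big_rec2: _ => [|i x y _ h]; first by rewrite cabs0.
by rewrite (le_trans (cabsD _ _))// lerD2l.
Qed.

Lemma Re_le_cabs z : `|complex.Re z| <= cabs z.
Proof.
by case: z => a b /=; rewrite -sqrtr_sqr ler_wsqrtr// lerDl sqr_ge0.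
Qed.

Lemma Im_le_cabs z : `|complex.Im z| <= cabs z.
Proof.
by case: z => a b /=; rewrite -sqrtr_sqr ler_wsqrtr// lerDr sqr_ge0.
Qed.

Lemma cabs_le_ReIm z : cabs z <= `|complex.Re z| + `|complex.Im z|.
Proof.
case: z => a b /=; rewrite -[leRHS]ger0_norm ?addr_ge0// -sqrtr_sqr.
rewrite ler_wsqrtr// sqrrD !real_normK ?num_real// lerD2r lerDl.
by rewrite mulrn_wge0// mulr_ge0.
Qed.

Lemma ReD x y : complex.Re (x + y) = complex.Re x + complex.Re y.
Proof. by case: x; case: y. Qed.
Lemma ImD x y : complex.Im (x + y) = complex.Im x + complex.Im y.
Proof. by case: x; case: y. Qed.
Lemma ReN x : complex.Re (- x) = - complex.Re x.
Proof. by case: x. Qed.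
Lemma ImN x : complex.Im (- x) = - complex.Im x.
Proof. by case: x. Qed.
Lemma ReM x y : complex.Re (x * y) =
  complex.Re x * complex.Re y - complex.Im x * complex.Im y.
Proof. by case: x; case: y. Qed.
Lemma ImM x y : complex.Im (x * y) =
  complex.Re x * complex.Im y + complex.Im x * complex.Re y.
Proof. by case: x; case: y. Qed.

Lemma complex_eta x : x = complex.Re x +i* complex.Im x.
Proof. by case: x. Qed.

End ComplexModulus.

Section Average.
Variable R : realType.
Implicit Types (f g : R -> R[i]).

(** Stated on the two parts separately, to match [cint], which integrates them separately. *)
Definition ccont f :=
  continuous (fun t : R => complex.Re (f t)) /\
  continuous (fun t : R => complex.Im (f t)).

Lemma ccontP f : (forall t (e : R), 0 < e ->
  \forall s \near t, cabs (f t - f s) <= e) -> ccont f.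
Proof.
move=> h; split=> t; apply/cvgrPdist_le => e e0; near=> s.
- by rewrite -ReN -ReD (le_trans (Re_le_cabs _))//; near: s; exact: h.
- by rewrite -ImN -ImD (le_trans (Im_le_cabs _))//; near: s; exact: h.
Unshelve. all: by end_near. Qed.

Lemma ccont_near f t (e : R) : ccont f -> 0 < e ->
  \forall s \near t, cabs (f t - f s) <= e.
Proof.
move=> [hr hi] e0; have e20 : 0 < e / 2 by rewrite divr_gt0.
have /cvgrPdist_le/(_ _ e20) h1 := hr t.
have /cvgrPdist_le/(_ _ e20) h2 := hi t.
near=> s; rewrite (le_trans (cabs_le_ReIm _))// ReD ImD ReN ImN.
by rewrite [leRHS](splitr e) lerD//; near: s.
Unshelve. all: by end_near. Qed.

Lemma ccont_cst (c : R[i]) : ccont (fun=> c).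
Proof. by split=> t; exact: cvg_cst. Qed.

Lemma ccontD f g : ccont f -> ccont g -> ccont (fun t => f t + g t).
Proof.
move=> [fr fi] [gr gi]; split=> t.
- under eq_fun do rewrite ReD; exact: (cvgD (fr t) (gr t)).
- under eq_fun do rewrite ImD; exact: (cvgD (fi t) (gi t)).
Qed.

Lemma ccontM f g : ccont f -> ccont g -> ccont (fun t => f t * g t).
Proof.
move=> [fr fi] [gr gi]; split=> t.
- under eq_fun do rewrite ReM.
  exact: (cvgB (cvgM (fr t) (gr t)) (cvgM (fi t) (gi t))).
- under eq_fun do rewrite ImM.
  exact: (cvgD (cvgM (fr t) (gi t)) (cvgM (fi t) (gr t))).
Qed.

Lemma ccontN f : ccont f -> ccont (fun t => - f t).
Proof.
move=> cf; under eq_fun do rewrite -mulN1r.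
by apply: ccontM => //; exact: ccont_cst.
Qed.

Lemma ccontB f g : ccont f -> ccont g -> ccont (fun t => f t - g t).
Proof. by move=> cf cg; apply: ccontD => //; exact: ccontN. Qed.

Lemma ccont_sum (I : Type) (s : seq I) (F : I -> R -> R[i]) :
  (forall i, ccont (F i)) -> ccont (fun t => \sum_(i <- s) F i t).
Proof.
move=> h; elim: s => [|i s ih].
  by under eq_fun do rewrite big_nil; exact: ccont_cst.
by under eq_fun do rewrite big_cons; exact: ccontD.
Qed.

Lemma ccont_expi (k : int) : ccont (expi k).
Proof.
have h : continuous (fun t : R => k%:~R * t).
  by move=> t; apply: cvgMr; exact: cvg_id.
split=> t; apply: (@continuous_comp _ _ _ (fun t : R => k%:~R * t)).
- exact: h.
- exact: continuous_cos.
- exact: h.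
- exact: continuous_sin.
Qed.

Local Notation D := (`[0, 2 * pi]%classic : set R).
Local Notation mu := (@lebesgue_measure R).

Lemma integrable_circle (f : R -> R) : continuous f ->
  mu.-integrable D (EFin \o f).
Proof.
move=> cf; apply: continuous_compact_integrable; first exact: segment_compact.
exact: continuous_subspaceT.
Qed.

Lemma cintD f g : ccont f -> ccont g ->
  cint (fun t => f t + g t) = cint f + cint g.
Proof.
move=> [fr fi] [gr gi]; rewrite /cint; apply/eqP; rewrite eq_complex /=.
under eq_Rintegral do rewrite ReD.
under [X in _ && (X == _)]eq_Rintegral do rewrite ImD.
by rewrite !RintegralD ?eqxx//; exact: integrable_circle.
Qed.

Lemma cintZ (c : R[i]) f : ccont f -> cint (fun t => c * f t) = c * cint f.
Proof.
move=> [fr fi]; rewrite /cint; apply/eqP; rewrite eq_complex /=.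
under eq_Rintegral do rewrite ReM.
under [X in _ && (X == _)]eq_Rintegral do rewrite ImM.
have h (r : R) (h : R -> R) : continuous h -> continuous (fun t => r * h t).
  by move=> ch t; apply: cvgMr; exact: ch.
rewrite RintegralB ?RintegralD//; do ?by apply: integrable_circle => //; exact: h.
rewrite !RintegralZl//; do ?by apply: integrable_circle.
by case: c => a b /=; rewrite !eqxx.
Qed.

Definition avg f : R[i] := (2 * pi)^-1%:C * cint f.

Lemma avgD f g : ccont f -> ccont g ->
  avg (fun t => f t + g t) = avg f + avg g.
Proof. by move=> cf cg; rewrite /avg cintD// mulrDr. Qed.

Lemma avgZ (c : R[i]) f : ccont f -> avg (fun t => c * f t) = c * avg f.
Proof. by move=> cf; rewrite /avg cintZ// mulrCA. Qed.

Lemma avgN f : ccont f -> avg (fun t => - f t) = - avg f.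
Proof.
move=> cf; under eq_fun do rewrite -mulN1r.
by rewrite avgZ// mulN1r.
Qed.

Lemma avgB f g : ccont f -> ccont g ->
  avg (fun t => f t - g t) = avg f - avg g.
Proof. by move=> cf cg; rewrite avgD ?avgN//; exact: ccontN. Qed.

Lemma avg0 : avg (fun=> 0) = 0.
Proof.
have := @avgZ 0 (fun=> 0) (ccont_cst 0).
by under eq_fun do rewrite mul0r; rewrite mul0r.
Qed.

Lemma avg_sum (I : Type) (s : seq I) (F : I -> R -> R[i]) :
  (forall i, ccont (F i)) ->
  avg (fun t => \sum_(i <- s) F i t) = \sum_(i <- s) avg (F i).
Proof.
move=> h; elim: s => [|i s ih].
  by under eq_fun do rewrite big_nil; rewrite big_nil avg0.
under eq_fun do rewrite big_cons.
by rewrite avgD ?ih ?big_cons//; exact: ccont_sum.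
Qed.

Lemma pi2_gt0 : 0 < 2 * pi :> R.
Proof. by rewrite mulr_gt0// pi_gt0. Qed.

Lemma Rintegral_circle_le (f : R -> R) (B : R) : continuous f ->
  (forall t, D t -> `|f t| <= B) -> `|\int[mu]_(t in D) f t| <= 2 * pi * B.
Proof.
move=> cf hB; apply: le_trans (le_normr_Rintegral _ _) _ => //.
  exact: integrable_circle.
apply: (@le_trans _ _ (\int[mu]_(t in D) B)).
  apply: le_Rintegral => //.
  - by apply: integrable_circle => t; apply: cvg_norm; exact: cf.
  - by apply: integrable_circle => t; exact: cvg_cst.
rewrite Rintegral_cst//; have := lebesgue_measure_itv `[(0:R), 2 * pi].
by rewrite /= lte_fin pi2_gt0 => -> /=; rewrite subr0 mulrC.
Qed.

(** The factor 2 comes from estimating the real and imaginary integrals separately; the bounds below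
    only have to be finite or small, so the loss is harmless. *)
Lemma cabs_avg f (B : R) : ccont f -> (forall t, D t -> cabs (f t) <= B) ->
  cabs (avg f) <= 2 * B.
Proof.
move=> [fr fi] hB; rewrite cabsM cabs_real gtr0_norm ?invr_gt0 ?pi2_gt0//.
rewrite mulrC ler_pdivrMr ?pi2_gt0//; apply: le_trans (cabs_le_ReIm _) _ => /=.
apply: (@le_trans _ _ (2 * pi * B + 2 * pi * B)); last lra.
apply: lerD; apply: Rintegral_circle_le => // t /hB.
- exact/le_trans/Re_le_cabs.
- exact/le_trans/Im_le_cabs.
Qed.

End Average.

Section Expi.
Variable R : realType.
Implicit Types (k l : int) (t : R).

Lemma expi0 t : expi 0 t = 1.
Proof. by rewrite /expi mul0r cos0 sin0. Qed.

Lemma expiD k l t : expi (k + l) t = expi k t * expi l t.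
Proof.
rewrite /expi intrD mulrDl cosD sinD; apply/eqP; rewrite eq_complex /=.
by apply/andP; split; apply/eqP; ring.
Qed.

Lemma cabs_expi k t : cabs (expi k t) = 1.
Proof. by rewrite /cabs /= cos2Dsin2 sqrtr1. Qed.

End Expi.

(** * Symmetric summation over the integers *)

Section SymmetricSums.
Variable R : realType.
Implicit Types (k l : int).

Lemma zsum0 (V : nmodType) (a : int -> V) : zsum 0 a = a 0.
Proof. by rewrite /zsum big_ord1 /= subr0. Qed.

Lemma zsumS (V : nmodType) (N : nat) (a : int -> V) :
  zsum N.+1 a = zsum N a + (a N.+1%:Z + a (- N.+1%:Z)).
Proof.
rewrite /zsum doubleS big_ord_recr big_ord_recl /=.
have e1 : N.*2.+2%:Z - N.+1%:Z = N.+1%:Z by lia.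
have e2 : 0%:Z - N.+1%:Z = - N.+1%:Z by lia.
have -> : \sum_(i < N.*2.+1) a ((bump 0 i)%:Z - N.+1%:Z) =
    \sum_(i < N.*2.+1) a (i%:Z - N%:Z).
  by apply: eq_bigr => i _; congr a; rewrite /bump /=; lia.
by rewrite e1 e2 addrAC addrC [X in _ + X]addrC.
Qed.

Lemma eq_zsum (V : nmodType) (N : nat) (a b : int -> V) :
  a =1 b -> zsum N a = zsum N b.
Proof. by move=> ab; apply: eq_bigr => i _; rewrite ab. Qed.

Lemma zsumD (V : nmodType) (N : nat) (a b : int -> V) :
  zsum N (fun k => a k + b k) = zsum N a + zsum N b.
Proof. exact: big_split. Qed.

Lemma zsum_opp (V : nmodType) (N : nat) (a : int -> V) :
  zsum N (fun k => a (- k)) = zsum N a.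
Proof.
elim: N => [|N ih]; first by rewrite !zsum0 oppr0.
by rewrite !zsumS ih opprK [in RHS](addrC (a _)).
Qed.

Lemma zsumZ (A : pzRingType) (N : nat) (c : A) (a : int -> A) :
  zsum N (fun k => c * a k) = c * zsum N a.
Proof. by rewrite /zsum mulr_sumr. Qed.

Lemma cabs_zsum (N : nat) (a : int -> R[i]) :
  cabs (zsum N a) <= zsum N (fun k => cabs (a k)).
Proof. exact: cabs_sum. Qed.

Lemma le_zsum (N : nat) (a b : int -> R) :
  (forall k, a k <= b k) -> zsum N a <= zsum N b.
Proof. by move=> ab; apply: ler_sum. Qed.

Definition lam (k : int) : R := if k == 0 then 1 else `|k%:~R|.

Lemma lamN k : lam (- k) = lam k.
Proof. by rewrite /lam oppr_eq0 intrN normrN. Qed.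

Lemma lam_ge1 k : 1 <= lam k.
Proof.
rewrite /lam; case: eqP => // /eqP k0; rewrite -intr_norm ler1z; lia.
Qed.

Lemma lam_gt0 k : 0 < lam k.
Proof. exact: lt_le_trans (lam_ge1 k). Qed.

Lemma lam_neq0 k : lam k != 0.
Proof. by rewrite gt_eqF// lam_gt0. Qed.

Lemma lam0 : lam 0 = 1.
Proof. by rewrite /lam eqxx. Qed.

(** Multiplicative form of the triangle inequality, available because [lam] is at least 1. It makes
    bounds by powers of [lam] stable under frequency shifts. *)
Lemma lamD k l : lam (k + l) <= 2 * lam k * lam l.
Proof.
have h1 := lam_ge1 k; have h2 := lam_ge1 l.
suff : lam (k + l) <= lam k + lam l by move=> h; nra.
rewrite {1}/lam; case: eqP => [_|kl]; first lra.
rewrite intrD (le_trans (ler_normD _ _))// /lam.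
by apply: lerD; case: eqP => // ->; rewrite normr0.
Qed.

Lemma lamS_pos (N : nat) : lam N.+1%:Z = N.+1%:R.
Proof. by rewrite /lam /= ger0_norm. Qed.

(** The fixed summable weight with which all infinite sums are compared. *)
Definition wgt k : R := (lam k) ^- 2.

Lemma wgt_ge0 k : 0 <= wgt k.
Proof. by rewrite invr_ge0 exprn_ge0// ltW// lam_gt0. Qed.

Lemma wgtN k : wgt (- k) = wgt k.
Proof. by rewrite /wgt lamN. Qed.

(** Telescoping: for x >= 1 the increment 2/x^2 is at most 4/x - 4/(x + 1), and the constant 5 gives
    equality at [N = 0]. *)
Lemma zsum_wgt_le (N : nat) : zsum N wgt <= 5 - 4 / N.+1%:R.
Proof.
elim: N => [|N ih]; first by rewrite zsum0 /wgt lam0 expr1n invr1; lra.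
rewrite zsumS wgtN /wgt lamS_pos.
set x : R := N.+1%:R in ih *.
have x1 : 1 <= x by rewrite /x ler1n.
have -> : N.+2%:R = x + 1 :> R by rewrite /x -natr1.
clearbody x.
have -> : 4 / (x + 1) = 4 / x - 4 / (x * (x + 1)) :> R by field; lra.
suff : x ^- 2 + x ^- 2 <= 4 / (x * (x + 1)).
  by move=> h; rewrite (le_trans (lerD ih h))// opprB -addrA lerD2l addrC.
have x0 : 0 < x by exact: lt_le_trans x1.
have xx0 : 0 < x * (x + 1) by rewrite mulr_gt0// addr_gt0.
rewrite ler_pdivlMr//.
have -> : (x ^- 2 + x ^- 2) * (x * (x + 1)) = 2 + 2 * x^-1.
  by field; rewrite gt_eqF.
have : x^-1 <= 1 by rewrite invf_le1.
move: (x^-1) => y; lra.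
Qed.

Lemma nondecreasing_zsum_wgt : nondecreasing_seq (fun N => zsum N wgt).
Proof.
by apply/nondecreasing_seqP => N; rewrite zsumS lerDl addr_ge0 ?wgt_ge0.
Qed.

Lemma cvg_zsum_wgt : cvgn (fun N => zsum N wgt).
Proof.
apply: nondecreasing_is_cvgn; first exact: nondecreasing_zsum_wgt.
exists 5 => _ [N _ <-]; rewrite (le_trans (zsum_wgt_le N))//.
by rewrite lerBlDr lerDl divr_ge0.
Qed.

Definition wtot : R := limn (fun N => zsum N wgt).
Definition wtail (N : nat) : R := wtot - zsum N wgt.

Lemma zsum_wgt_le_wtot N : zsum N wgt <= wtot.
Proof.
by apply: nondecreasing_cvgn_le; [exact: nondecreasing_zsum_wgt|exact: cvg_zsum_wgt].
Qed.

Lemma wtot_ge0 : 0 <= wtot.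
Proof.
by rewrite (le_trans _ (zsum_wgt_le_wtot 0))// zsum0 wgt_ge0.
Qed.

Lemma wtail_ge0 N : 0 <= wtail N.
Proof. by rewrite subr_ge0 zsum_wgt_le_wtot. Qed.

Lemma wtail_le_wtot N : wtail N <= wtot.
Proof. by rewrite lerBlDr lerDl sumr_ge0// => i _; exact: wgt_ge0. Qed.

Lemma wtail_small (C e : R) : 0 < e ->
  exists N0, forall N, (N0 <= N)%N -> C * wtail N <= e.
Proof.
move=> e0; have C0 : 0 < `|C| + 1 by rewrite ltr_wpDl.
have /cvgrPdist_le/(_ (e / (`|C| + 1))) := cvg_zsum_wgt.
rewrite divr_gt0// => /(_ isT) [N0 _ h]; exists N0 => N /h.
rewrite -/wtot -/(wtail N) ger0_norm ?wtail_ge0// ler_pdivlMr// mulrC.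
have := wtail_ge0 N; have := ler_norm C => *; nra.
Qed.

(** Convergence of symmetric partial sums in the complex modulus, which spares a split into parts;
    [zser] is merely the value returned by [lim]. *)
Definition zconv (a : int -> R[i]) (z : R[i]) := forall e : R, 0 < e ->
  exists N0, forall N, (N0 <= N)%N -> cabs (z - zsum N a) <= e.

Definition zser (a : int -> R[i]) : R[i] := clim (fun N => zsum N a).

Lemma cvg_clim (u : nat -> R[i]) z :
  (fun N => complex.Re (u N)) @ \oo --> complex.Re z ->
  (fun N => complex.Im (u N)) @ \oo --> complex.Im z -> clim u = z.
Proof.
by move=> hr hi; rewrite [z]complex_eta /clim (cvg_lim _ hr)// (cvg_lim _ hi).
Qed.

Lemma zconv_zser a z : zconv a z -> zser a = z.
Proof.
move=> h; apply: cvg_clim; apply/cvgrPdist_le => e /h[N0 hN]; exists N0 => // N /hN.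
- by apply: le_trans; rewrite -ReN -ReD Re_le_cabs.
- by apply: le_trans; rewrite -ImN -ImD Im_le_cabs.
Qed.

Lemma zconvD a b x y : zconv a x -> zconv b y ->
  zconv (fun k => a k + b k) (x + y).
Proof.
move=> ha hb e e0; have e2 : 0 < e / 2 by rewrite divr_gt0.
have [N1 h1] := ha _ e2; have [N2 h2] := hb _ e2.
exists (maxn N1 N2) => N; rewrite geq_max => /andP[/h1 {}h1 /h2 {}h2].
rewrite zsumD opprD addrACA (le_trans (cabsD _ _))// [leRHS](splitr e).
exact: lerD.
Qed.

Lemma zconvZ (c : R[i]) a x : zconv a x -> zconv (fun k => c * a k) (c * x).
Proof.
move=> ha e e0; have C0 : 0 < cabs c + 1 by rewrite ltr_wpDl// cabs_ge0.
have [N0 h] := ha (e / (cabs c + 1)) (divr_gt0 e0 C0); exists N0 => N /h hN.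
rewrite zsumZ -mulrBr cabsM.
apply: (@le_trans _ _ ((cabs c + 1) * cabs (x - zsum N a))).
  by rewrite ler_wpM2r ?cabs_ge0// lerDl ler01.
by rewrite mulrC -ler_pdivlMr.
Qed.

Lemma zconv_opp a x : zconv a x -> zconv (fun k => a (- k)) x.
Proof. by move=> ha e /ha[N0 h]; exists N0 => N /h; rewrite zsum_opp. Qed.

Definition dominated (C : R) (a : int -> R[i]) :=
  forall k, cabs (a k) <= C * wgt k.

Lemma dominated_ge0 C a : dominated C a -> 0 <= C.
Proof.
move/(_ 0); rewrite /wgt lam0 expr1n invr1 mulr1; exact/le_trans/cabs_ge0.
Qed.

Lemma zsum_dominated C a M N : dominated C a -> (N <= M)%N ->
  cabs (zsum M a - zsum N a) <= C * (zsum M wgt - zsum N wgt).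
Proof.
move=> da /subnK <-; elim: (M - N)%N => [|m ih].
  by rewrite add0n !subrr cabs0 mulr0.
rewrite addSn !zsumS addrAC (le_trans (cabsD _ _))//.
rewrite [X in C * X]addrAC mulrDr lerD// mulrDr (le_trans (cabsD _ _))//.
by rewrite lerD.
Qed.

Lemma cabs_zsum_dominated C a N : dominated C a -> cabs (zsum N a) <= C * wtot.
Proof.
move=> da; apply: (@le_trans _ _ (C * zsum N wgt)).
  rewrite (le_trans (cabs_zsum _ _))// -zsumZ; exact: le_zsum.
by rewrite ler_wpM2l ?zsum_wgt_le_wtot// (dominated_ge0 da).
Qed.

(** Adding [C] times the partial sums of the weight makes [u] nondecreasing and bounded, so [u] is a
    difference of two convergent sequences. *)
Lemma dominated_cvg C (u : nat -> R) :
  (forall M N, (N <= M)%N -> `|u M - u N| <= C * (zsum M wgt - zsum N wgt)) ->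
  cvgn u.
Proof.
move=> hu.
have cw : cvgn (fun N => C * zsum N wgt).
  by apply: is_cvgMr; exact: cvg_zsum_wgt.
(* The sign of [C] is read off from the case [M = 1], [N = 0], where the weight increases by
   [2 * wgt 1 > 0]. *)
have C0 : 0 <= C * wgt 1.
  have := hu 1%N 0%N isT; rewrite zsumS [X in _ * X]addrAC subrr add0r wgtN.
  by rewrite mulrDr => /(le_trans (normr_ge0 _)); rewrite -mulr2n pmulrn_lge0.
have {}C0 : 0 <= C.
  by move: C0; rewrite pmulr_lge0// invr_gt0 exprn_gt0// lam_gt0.
have -> : u = (fun N => (C * zsum N wgt + u N) - C * zsum N wgt).
  by apply/funext => N; rewrite addrAC subrr add0r.
apply: is_cvgB => //; apply: nondecreasing_is_cvgn.
  move=> N M NM; have := hu _ _ NM; rewrite ler_norml => /andP[h _]; lra.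
exists (C * wtot + (`|u 0%N| + C * wtot)) => _ [N _ <-].
have hN : C * zsum N wgt <= C * wtot by rewrite ler_wpM2l ?zsum_wgt_le_wtot.
apply: lerD => //; have := hu N 0%N (leq0n _); rewrite ler_norml => /andP[_ h].
have := ler_norm (u 0%N).
have : 0 <= C * zsum 0 wgt by rewrite zsum0 mulr_ge0// wgt_ge0.
lra.
Qed.

Lemma zser_tail C a N : dominated C a ->
  cabs (zser a - zsum N a) <= C * wtail N.
Proof.
move=> da; have C0 := dominated_ge0 da.
have cr : cvgn (fun N => complex.Re (zsum N a)).
  apply: (@dominated_cvg C) => M m mM.
  by rewrite -ReN -ReD (le_trans (Re_le_cabs _))// zsum_dominated.
have ci : cvgn (fun N => complex.Im (zsum N a)).
  apply: (@dominated_cvg C) => M m mM.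
  by rewrite -ImN -ImD (le_trans (Im_le_cabs _))// zsum_dominated.
apply/ler_addgt0Pr => e e0; have e2 : 0 < e / 2 by rewrite divr_gt0.
move/cvgrPdist_le: cr => /(_ _ e2)[N1 _ h1].
move/cvgrPdist_le: ci => /(_ _ e2)[N2 _ h2].
set M := maxn N (maxn N1 N2).
have NM : (N <= M)%N by rewrite leq_max leqnn.
have := h1 M; rewrite /= !leq_max leqnn orbT => /(_ isT) {}h1.
have := h2 M; rewrite /= !leq_max leqnn !orbT => /(_ isT) {}h2.
rewrite -[zser a](subrK (zsum M a)) -addrA addrC (le_trans (cabsD _ _))//.
apply: lerD.
  rewrite (le_trans (zsum_dominated da NM))// ler_wpM2l// lerD2r.
  exact: zsum_wgt_le_wtot.
rewrite (le_trans (cabs_le_ReIm _))// ReD ImD ReN ImN [leRHS](splitr e).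
exact: lerD.
Qed.

Lemma dominated_zconv C a : dominated C a -> zconv a (zser a).
Proof.
move=> da e /(wtail_small C)[N0 h]; exists N0 => N /h; exact/le_trans/zser_tail.
Qed.

Lemma cabs_zser C a : dominated C a -> cabs (zser a) <= 2 * C * wtot.
Proof.
move=> da; rewrite -[zser a](subrK (zsum 0 a)) (le_trans (cabsD _ _))//.
have -> : 2 * C * wtot = C * wtot + C * wtot by ring.
rewrite lerD ?(cabs_zsum_dominated _ da)// (le_trans (zser_tail 0 da))//.
by rewrite ler_wpM2l ?wtail_le_wtot// (dominated_ge0 da).
Qed.

Lemma eq_zser a b : a =1 b -> zser a = zser b.
Proof. by move=> /funext ->. Qed.

Lemma zserD C C' a b : dominated C a -> dominated C' b ->
  zser (fun k => a k + b k) = zser a + zser b.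
Proof.
by move=> /dominated_zconv ha /dominated_zconv hb; apply/zconv_zser/zconvD.
Qed.

Lemma zserZ C c a : dominated C a -> zser (fun k => c * a k) = c * zser a.
Proof. by move=> /dominated_zconv ha; apply/zconv_zser/zconvZ. Qed.

Lemma zser_opp C a : dominated C a -> zser (fun k => a (- k)) = zser a.
Proof. by move=> /dominated_zconv ha; apply/zconv_zser/zconv_opp. Qed.

(** Symmetric partial sums are not shift invariant; the defect consists of two boundary terms, which
    domination sends to 0. *)
Lemma zsum_shift1 N (a : int -> R[i]) :
  zsum N (fun k => a (k + 1)) = zsum N a + (a N.+1%:Z - a (- N%:Z)).
Proof.
elim: N => [|N ih]; first by rewrite !zsum0 add0r oppr0 addrCA subrr addr0.
rewrite !zsumS ih.
have -> : N.+1%:Z + 1 = N.+2%:Z by lia.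
have -> : - N.+1%:Z + 1 = - N%:Z by lia.
ring.
Qed.

Lemma zconv_shift1 C a z : dominated C a -> zconv a z ->
  zconv (fun k => a (k + 1)) z.
Proof.
move=> da az e e0; have e2 : 0 < e / 2 by rewrite divr_gt0.
have [N1 h1] := az _ e2; have [N2 h2] := wtail_small (2 * C) e2.
have C0 := dominated_ge0 da.
(* At the partial sum of index [N.+1] the boundary indices are [N.+2] and [- N.+1]; each lies one
   step beyond a symmetric range, so its weight is part of a tail. *)
exists (maxn N1 N2).+1 => -[//|N]; rewrite ltnS geq_max => /andP[N1N N2N].
rewrite zsum_shift1 opprD addrA (le_trans (cabsB _ _))// [leRHS](splitr e).
apply: lerD; first by apply: h1; exact: leqW.
have := h2 _ N2N; apply: le_trans; rewrite (le_trans (cabsB _ _))//.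
have tl (n : nat) : wgt n.+1%:Z <= wtail n.
  rewrite /wtail lerBrDr; apply: le_trans (zsum_wgt_le_wtot n.+1).
  by rewrite (zsumS n) addrC lerD2r lerDl wgt_ge0.
have t1 : C * wgt N.+2%:Z <= C * wtail N.+1 by rewrite ler_wpM2l.
have t2 : C * wgt (- N.+1%:Z) <= C * wtail N by rewrite wgtN ler_wpM2l.
have t3 : C * wtail N.+1 <= C * wtail N.
  rewrite ler_wpM2l// lerD2l lerN2; exact: nondecreasing_zsum_wgt.
have := da N.+2%:Z; have := da (- N.+1%:Z); lra.
Qed.

Lemma dominated_shift C a l : dominated C a ->
  dominated (C * (2 * lam l) ^+ 2) (fun k => a (k + l)).
Proof.
move=> da k; rewrite (le_trans (da _))// -mulrA ler_wpM2l ?(dominated_ge0 da)//.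
have := lamD (k + l) (- l); rewrite addrK lamN.
rewrite /wgt => h; have k0 := lam_gt0 k; have kl0 := lam_gt0 (k + l).
rewrite ler_pdivlMr ?exprn_gt0// mulrC ler_pdivrMr ?exprn_gt0//.
rewrite -exprMn; apply: lerXn2r; rewrite ?nnegrE 1?mulrAC//.
- exact: ltW.
- by rewrite !mulr_ge0 ?ltW ?lam_gt0.
Qed.

Lemma zser_shift C a l : dominated C a ->
  zser (fun k => a (k + l)) = zser a.
Proof.
move=> da; apply: zconv_zser.
have pos (m : nat) : forall b D, dominated D b ->
    zconv (fun k => b (k + m%:Z)) (zser b).
  elim: m => [|m ih] b D db.
    by under eq_fun do rewrite addr0; exact: dominated_zconv db.
  have := zconv_shift1 (dominated_shift m%:Z db) (ih _ _ db).
  by under eq_fun do rewrite -addrA addrC -[1]/(1%:Z) -PoszD addnC addn1 addrC.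
(* A negative shift is a positive shift of the reflected sequence. *)
have [m [->|->]] : exists m : nat, l = m%:Z \/ l = - m%:Z.
  by exists `|l|%N; lia.
  exact: pos da.
have dN : dominated C (fun k => a (- k)) by move=> k; rewrite -wgtN.
have := zconv_opp (pos m _ _ dN); rewrite (zser_opp da).
by under eq_fun do rewrite opprD opprK.
Qed.

Lemma zsum_single (p : int) (c : R[i]) N : (`|p| <= N)%N ->
  zsum N (fun k => if k == p then c else 0) = c.
Proof.
move=> pN; have hp : (absz (p + N%:Z)%R < N.*2.+1)%N by lia.
rewrite /zsum (bigD1 (Ordinal hp))//= (_ : _ == p) ?big1 ?addr0//; last by lia.
move=> i /eqP hi; case: eqP => // hip; case: hi; apply: val_inj => /=; lia.
Qed.

Lemma zser_single (p : int) (c : R[i]) :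
  zser (fun k => if k == p then c else 0) = c.
Proof.
apply: zconv_zser => e e0; exists `|p|%N => N pN.
by rewrite zsum_single// subrr cabs0 ltW.
Qed.

End SymmetricSums.

(** * Fourier coefficients and Fourier multipliers *)

Section Fourier.
Variable R : realType.
Implicit Types (f g h : R -> R[i]) (phi : int -> R).

Definition cderiv f (df : R -> R[i]) := forall t : R,
  is_derive t 1 (fun s : R => complex.Re (f s)) (complex.Re (df t)) /\
  is_derive t 1 (fun s : R => complex.Im (f s)) (complex.Im (df t)).

Lemma cderivM f df g dg : cderiv f df -> cderiv g dg ->
  cderiv (fun t => f t * g t) (fun t => df t * g t + f t * dg t).
Proof.
move=> hf hg t; have [fr fi] := hf t; have [gr gi] := hg t; split.
- under eq_fun do rewrite ReM.
  apply: is_derive_eq; rewrite /GRing.scale /= ReD !ReM; ring.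
- under eq_fun do rewrite ImM.
  apply: is_derive_eq; rewrite /GRing.scale /= ImD !ImM; ring.
Qed.

Lemma cderiv_expi (k : int) :
  cderiv (@expi R k) (fun t => (0 +i* k%:~R) * expi k t).
Proof.
move=> t.
have hk : is_derive t 1 ( *%R (k%:~R : R)) k%:~R.
  have := is_deriveZ (k%:~R : R) (is_derive_id t (1 : R)).
  by rewrite /GRing.scale /= mulr1.
split=> /=.
- have := @is_derive1_comp R cos ( *%R k%:~R) t _ _ (is_derive_cos _) hk.
  by rewrite mul0r sub0r mulNr mulrC.
- have := @is_derive1_comp R sin ( *%R k%:~R) t _ _ (is_derive_sin _) hk.
  by rewrite mul0r add0r mulrC.
Qed.

Lemma FTC_circle (F f : R -> R) : continuous f ->
  (forall t : R, is_derive t 1 F (f t)) -> F (2 * pi) = F 0 ->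
  \int[lebesgue_measure]_(t in `[0, 2 * pi]) f t = 0.
Proof.
move=> cf dF per.
have cF : continuous F.
  move=> t; apply: differentiable_continuous; apply/derivable1_diffP.
  by have := dF t => -[].
rewrite /Rintegral (@continuous_FTC2 R f F) ?pi2_gt0//=.
- by rewrite per subrr.
- exact: continuous_subspaceT.
- split.
  + by move=> t _; have := dF t => -[].
  + by apply: cvg_at_right_filter; exact: cF.
  + by apply: cvg_at_left_filter; exact: cF.
- by move=> t _; rewrite derive1E; have := dF t => -[].
Qed.

Lemma avg_cderiv f df : cderiv f df -> ccont df -> f (2 * pi) = f 0 ->
  avg df = 0.
Proof.
move=> fdf [cr ci] per; rewrite /avg /cint.
have -> := FTC_circle cr (fun t => (fdf t).1); last by rewrite per.
have -> := FTC_circle ci (fun t => (fdf t).2); last by rewrite per.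
by rewrite mulr0.
Qed.

Lemma expi_periodic (k : int) : @expi R k (2 * pi) = expi k 0.
Proof.
rewrite -[k]intz; have pos (m : nat) : @expi R m%:Z (2 * pi) = 1.
  elim: m => [|m ih]; first by rewrite expi0.
  rewrite -addn1 PoszD expiD ih mul1r /expi mul1r mulrC mulr_natr.
  by rewrite cos2pi sin2pi.
have e0 (l : int) : @expi R l 0 = 1 by rewrite /expi mulr0 cos0 sin0.
rewrite intz e0; case: k => [m|m]; first exact: pos.
rewrite NegzE; have := @expiD R (- m.+1%:Z) m.+1%:Z (2 * pi).
by rewrite addNr expi0 pos mulr1 => <-.
Qed.

Lemma avg1 : avg (fun=> 1 : R[i]) = 1.
Proof.
rewrite /avg /cint /= !Rintegral_cst//.
have := lebesgue_measure_itv `[(0:R), 2 * pi].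
rewrite /= lte_fin pi2_gt0 => -> /=; rewrite subr0 mul1r mul0r.
by rewrite -rmorphM /= mulVf ?gt_eqF ?pi2_gt0.
Qed.

(** For [k != 0], the mean times i k is the mean of the derivative of a periodic function, hence
    0. *)
Lemma avg_expi (k : int) : avg (@expi R k) = if k == 0 then 1 else 0.
Proof.
case: eqP => [->|/eqP k0].
  by rewrite -[RHS]avg1; congr avg; apply/funext => t; rewrite expi0.
have := avg_cderiv (cderiv_expi k) _ (expi_periodic k).
rewrite avgZ; last exact: ccont_expi.
have cx : ccont (fun t : R => (0 +i* k%:~R) * expi k t).
  by apply: ccontM; [exact: ccont_cst|exact: ccont_expi].
move=> /(_ cx) /eqP; rewrite mulf_eq0 => /orP[|/eqP //].
by rewrite eq_complex /= intr_eq0 (negbTE k0) andbF.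
Qed.

Definition fc f (k : int) : R[i] := avg (fun t => expi (- k) t * f t).

Lemma fcD f g k : ccont f -> ccont g ->
  fc (fun t => f t + g t) k = fc f k + fc g k.
Proof.
move=> cf cg; rewrite /fc -avgD; do ?by apply: ccontM => //; exact: ccont_expi.
by under eq_fun do rewrite mulrDr.
Qed.

Lemma fcZ (c : R[i]) f k : ccont f -> fc (fun t => c * f t) k = c * fc f k.
Proof.
move=> cf; rewrite /fc -avgZ; last by apply: ccontM => //; exact: ccont_expi.
by under eq_fun do rewrite mulrCA.
Qed.

Lemma fcN f k : ccont f -> fc (fun t => - f t) k = - fc f k.
Proof. by move=> cf; under eq_fun do rewrite -mulN1r; rewrite fcZ// mulN1r. Qed.

Lemma fcB f g k : ccont f -> ccont g ->
  fc (fun t => f t - g t) k = fc f k - fc g k.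
Proof. by move=> cf cg; rewrite fcD ?fcN//; exact: ccontN. Qed.

Lemma fc_sum (I : Type) (s : seq I) (F : I -> R -> R[i]) k :
  (forall i, ccont (F i)) ->
  fc (fun t => \sum_(i <- s) F i t) k = \sum_(i <- s) fc (F i) k.
Proof.
move=> h; rewrite /fc; under eq_fun do rewrite mulr_sumr.
by rewrite avg_sum// => i; apply: ccontM => //; exact: ccont_expi.
Qed.

Lemma fc_expiM f (l k : int) : fc (fun t => expi l t * f t) k = fc f (k - l).
Proof.
rewrite /fc; congr avg; apply/funext => t.
by rewrite mulrA -expiD opprB addrC.
Qed.

Lemma fc_expi (l k : int) : fc (@expi R l) k = if k == l then 1 else 0.
Proof.
rewrite /fc; under eq_fun do rewrite -expiD.
by rewrite avg_expi addrC subr_eq0 eq_sym.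
Qed.

Definition decay (m : nat) (C : R) f :=
  forall k, cabs (fc f k) <= C * (lam R k) ^- m.

Lemma lamX_gt0 (m : nat) k : 0 < (lam R k) ^- m.
Proof. by rewrite invr_gt0 exprn_gt0// lam_gt0. Qed.

Lemma decay_ge0 m C f : decay m C f -> 0 <= C.
Proof.
move=> /(_ 0); rewrite lam0 expr1n invr1 mulr1; exact/le_trans/cabs_ge0.
Qed.

(** Stands in for smoothness: stability under multipliers is then an estimate on coefficients, with
    no differentiation of series. *)
Definition rapid f := ccont f /\ forall m, exists C, decay m C f.

Lemma rapid_ccont f : rapid f -> ccont f. Proof. by case. Qed.

Lemma rapidD f g : rapid f -> rapid g -> rapid (fun t => f t + g t).
Proof.
move=> [cf df] [cg dg]; split; first exact: ccontD.
move=> m; have [C hC] := df m; have [C' hC'] := dg m.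
exists (C + C') => k; rewrite fcD// mulrDl (le_trans (cabsD _ _))//.
exact: lerD.
Qed.

Lemma rapidZ (c : R[i]) f : rapid f -> rapid (fun t => c * f t).
Proof.
move=> [cf df]; split; first by apply: ccontM => //; exact: ccont_cst.
move=> m; have [C hC] := df m; exists (cabs c * C) => k.
by rewrite fcZ// cabsM -mulrA ler_wpM2l// cabs_ge0.
Qed.

Lemma rapidB f g : rapid f -> rapid g -> rapid (fun t => f t - g t).
Proof.
move=> rf rg; apply: rapidD => //.
by under eq_fun do rewrite -mulN1r; exact: rapidZ.
Qed.

Lemma rapid_sum (I : Type) (s : seq I) (F : I -> R -> R[i]) :
  (forall i, rapid (F i)) -> rapid (fun t => \sum_(i <- s) F i t).
Proof.
move=> h; elim: s => [|i s ih].
  under eq_fun do rewrite big_nil; split; first exact: ccont_cst.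
  move=> m; exists 0 => k; rewrite mul0r /fc.
  by under eq_fun do rewrite mulr0; rewrite avg0 cabs0.
by under eq_fun do rewrite big_cons; exact: rapidD.
Qed.

Lemma lamVX_le (m : nat) (k l : int) :
  (lam R (k - l)) ^- m <= (2 * lam R l) ^+ m * (lam R k) ^- m.
Proof.
rewrite ler_pdivlMr ?exprn_gt0 ?lam_gt0// mulrC ler_pdivrMr ?exprn_gt0 ?lam_gt0//.
rewrite -exprMn; apply: lerXn2r; rewrite ?nnegrE.
- by rewrite ltW// lam_gt0.
- by rewrite !mulr_ge0 ?ltW ?lam_gt0.
- by rewrite -[in leLHS](subrK l k) mulrAC lamD.
Qed.

Lemma decay_expiM m C f l : decay m C f ->
  decay m (C * (2 * lam R l) ^+ m) (fun t => expi l t * f t).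
Proof.
move=> df k; rewrite fc_expiM (le_trans (df _))// -mulrA.
by rewrite ler_wpM2l ?(decay_ge0 df)// lamVX_le.
Qed.

Lemma rapid_expiM f l : rapid f -> rapid (fun t => expi l t * f t).
Proof.
move=> [cf df]; split; first by apply: ccontM => //; exact: ccont_expi.
by move=> m; have [C hC] := df m; eexists; exact: decay_expiM hC.
Qed.

Lemma rapid_expi l : rapid (@expi R l).
Proof.
split; first exact: ccont_expi.
move=> m; exists (lam R l ^+ m) => k; rewrite fc_expi; case: eqP => [->|_].
  rewrite -[1]/(1%:C) cabs_real normr1 mulfV//.
  by rewrite expf_neq0// lam_neq0.
by rewrite cabs0 mulr_ge0 ?ltW ?lamX_gt0// exprn_gt0// lam_gt0.
Qed.

(** A symbol of order at most 1 turns [decay 3] into domination by [wgt]; this is why exponent 3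
    recurs below. *)
Definition order1 phi := forall k, `|phi k| <= lam R k.

Definition mult phi f : R -> R[i] := fun t =>
  zser (fun k => (phi k)%:C * (expi k t * fc f k)).

Lemma dominated_mult phi C f (x : int -> R[i]) : order1 phi -> decay 3 C f ->
  (forall k, cabs (x k) <= 1) ->
  dominated C (fun k => (phi k)%:C * (x k * fc f k)).
Proof.
move=> hp df hx k; rewrite 2!cabsM cabs_real.
have -> : C * wgt R k = lam R k * (1 * (C * (lam R k) ^- 3)).
  by rewrite /wgt; field; rewrite lam_neq0.
apply: ler_pM; rewrite ?mulr_ge0 ?cabs_ge0//.
by apply: ler_pM; rewrite ?cabs_ge0.
Qed.

Lemma dominated_mult_expi phi C f t : order1 phi -> decay 3 C f ->
  dominated C (fun k => (phi k)%:C * (expi k t * fc f k)).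
Proof.
by move=> hp df; apply: dominated_mult => // k; rewrite cabs_expi.
Qed.

Lemma mult_tail phi C f t N : order1 phi -> decay 3 C f ->
  cabs (mult phi f t - zsum N (fun k => (phi k)%:C * (expi k t * fc f k)))
    <= C * wtail R N.
Proof. by move=> hp df; apply: zser_tail; exact: dominated_mult_expi. Qed.

Lemma cabs_mult phi C f t : order1 phi -> decay 3 C f ->
  cabs (mult phi f t) <= 2 * C * wtot R.
Proof. by move=> hp df; apply: cabs_zser; exact: dominated_mult_expi. Qed.

Lemma ccont_zsum N (F : int -> R -> R[i]) : (forall k, ccont (F k)) ->
  ccont (fun t => zsum N (fun k => F k t)).
Proof. by move=> h; exact: ccont_sum. Qed.

(** The bound in [mult_tail] does not depend on [t], so this is a uniform limit of trigonometric
    polynomials. *)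
Lemma ccont_mult phi C f : order1 phi -> decay 3 C f -> ccont (mult phi f).
Proof.
move=> hp df; apply: ccontP => t e e0.
have e3 : 0 < e / 3 by rewrite divr_gt0.
have [N /(_ N (leqnn N)) hN] := wtail_small C e3.
pose S s := zsum N (fun k => (phi k)%:C * (expi k s * fc f k)).
have cS : ccont S.
  apply: ccont_zsum => k; apply: ccontM; first exact: ccont_cst.
  by apply: ccontM; [exact: ccont_expi|exact: ccont_cst].
have hS := ccont_near t cS e3.
near=> s.
have -> : mult phi f t - mult phi f s =
   (mult phi f t - S t) + (S t - S s) - (mult phi f s - S s) by ring.
have h1 : cabs (S t - S s) <= e / 3 by near: s.
have h2 := le_trans (mult_tail t N hp df) hN.
have h3 := le_trans (mult_tail s N hp df) hN.
have := cabsB (mult phi f t - S t + (S t - S s)) (mult phi f s - S s).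
have := cabsD (mult phi f t - S t) (S t - S s).
rewrite -/(S t) -/(S s) in h2 h3; lra.
Unshelve. all: by end_near. Qed.

Lemma ccont_bounded f : ccont f ->
  exists B, forall t, `[0, 2 * pi]%classic t -> cabs (f t) <= B.
Proof.
move=> [cr ci].
have bd (u : R -> R) : continuous u ->
    exists B, forall t, `[0, 2 * pi]%classic t -> `|u t| <= B.
  move=> cu; have : compact (u @` `[0, 2 * pi]).
    apply: continuous_compact; last exact: segment_compact.
    exact: continuous_subspaceT.
  move=> /compact_bounded[M [_ hM]]; exists (M + 1) => t tD.
  by apply: hM; [rewrite ltrDl|exists t].
have [B1 h1] := bd _ cr; have [B2 h2] := bd _ ci.
exists (B1 + B2) => t tD; rewrite (le_trans (cabs_le_ReIm _))// lerD//.
- exact: h1.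
- exact: h2.
Qed.

(** Term-by-term integration, justified by the uniform convergence of the partial sums [S]. *)
Lemma avg_mult phi C f h : order1 phi -> decay 3 C f -> ccont h ->
  avg (fun t => h t * mult phi f t) =
  zser (fun k => (phi k)%:C * (fc h (- k) * fc f k)).
Proof.
move=> hp df ch; apply/esym/zconv_zser => e e0.
have [B hB] := ccont_bounded ch.
(* The 2 is the loss in [cabs_avg], [B] bounds [h], and [C] belongs to the tail of the series. *)
have [N0 hN] := wtail_small (2 * (`|B| * C)) e0; exists N0 => N {}/hN.
apply: le_trans.
pose S t := zsum N (fun k => (phi k)%:C * (expi k t * fc f k)).
have cS : ccont S.
  apply: ccont_zsum => k; apply: ccontM; first exact: ccont_cst.
  by apply: ccontM; [exact: ccont_expi|exact: ccont_cst].
have -> : zsum N (fun k => (phi k)%:C * (fc h (- k) * fc f k)) =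
    avg (fun t => h t * S t).
  rewrite [RHS](_ : _ = avg (fun t => \sum_(i < N.*2.+1) h t *
    ((phi (i%:Z - N%:Z))%:C * (expi (i%:Z - N%:Z) t * fc f (i%:Z - N%:Z))))).
    2: by congr avg; apply/funext => t; rewrite /S /zsum mulr_sumr.
  rewrite avg_sum; last first.
    move=> i; apply: ccontM => //; apply: ccontM; first exact: ccont_cst.
    by apply: ccontM; [exact: ccont_expi|exact: ccont_cst].
  apply: eq_bigr => i _; set k := (_ - _ : int).
  rewrite /fc opprK [_ * avg _]mulrC mulrA -avgZ; last first.
    by apply: ccontM => //; exact: ccont_expi.
  by congr avg; apply/funext => t; rewrite -/(fc f k); ring.
have cm := ccont_mult hp df.
rewrite -avgB; do ?exact: ccontM.
rewrite -mulrA; apply: cabs_avg.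
  by apply: ccontB; exact: ccontM.
move=> t tD; rewrite -mulrBr cabsM -mulrA.
have hB' : cabs (h t) <= `|B| by rewrite (le_trans (hB t tD))// ler_norm.
by apply: ler_pM; rewrite ?cabs_ge0 ?mult_tail.
Qed.

Lemma fc_mult phi C f k : order1 phi -> decay 3 C f ->
  fc (mult phi f) k = (phi k)%:C * fc f k.
Proof.
move=> hp df; rewrite /fc (avg_mult hp df); last exact: ccont_expi.
rewrite -/(fc f k) -[RHS](zser_single k); apply: eq_zser => l.
by rewrite fc_expi eqr_opp; case: eqP => [->|_]; rewrite ?mul1r ?mul0r ?mulr0.
Qed.

Lemma fcoefE n (X : cloop R n) k j :
  fcoef X k ord0 j = fc (fun t => X t ord0 j) k.
Proof. by rewrite mxE. Qed.

Lemma fcalcE n (phi : R -> R) (T : operator R n) (X : cloop R n) t j :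
  fcalc phi T X t ord0 j =
  mult (fun k => phi (eigenval T k)) (fun s => X s ord0 j) t.
Proof.
rewrite mxE; apply: eq_zser => k.
by rewrite mxE fcoefE.
Qed.

End Fourier.

(** * The bilinear pairing and rapidly decreasing functions *)

Section Multipliers.
Variable R : realType.
Implicit Types (f g h u v w : R -> R[i]) (phi psi : int -> R).

Definition even phi := forall k, phi (- k) = phi k.

(** Bilinear, without conjugation: it is symmetric, and [expi k] is dual to [expi (- k)]. *)
Definition pr f g : R[i] := avg (fun t => f t * g t).

Lemma prC f g : pr f g = pr g f.
Proof. by congr avg; apply/funext => t; rewrite mulrC. Qed.

Lemma prDr f g h : ccont f -> ccont g -> ccont h ->
  pr f (fun t => g t + h t) = pr f g + pr f h.
Proof.
move=> cf cg ch; rewrite /pr -avgD; do ?exact: ccontM.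
by congr avg; apply/funext => t; rewrite mulrDr.
Qed.

Lemma prZr c f g : ccont f -> ccont g ->
  pr f (fun t => c * g t) = c * pr f g.
Proof.
move=> cf cg; rewrite /pr -avgZ; last exact: ccontM.
by congr avg; apply/funext => t; rewrite mulrCA.
Qed.

Lemma prBr f g h : ccont f -> ccont g -> ccont h ->
  pr f (fun t => g t - h t) = pr f g - pr f h.
Proof.
move=> cf cg ch; rewrite prDr//; last exact: ccontN.
congr (_ + _); rewrite -mulN1r -prZr//; congr avg.
by apply/funext => t; rewrite mulN1r.
Qed.

Lemma prDl f g h : ccont f -> ccont g -> ccont h ->
  pr (fun t => g t + h t) f = pr g f + pr h f.
Proof. by move=> *; rewrite prC prDr// prC [pr f h]prC. Qed.

Lemma prZl c f g : ccont f -> ccont g ->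
  pr (fun t => c * g t) f = c * pr g f.
Proof. by move=> *; rewrite prC prZr// prC. Qed.

Lemma prBl f g h : ccont f -> ccont g -> ccont h ->
  pr (fun t => g t - h t) f = pr g f - pr h f.
Proof. by move=> *; rewrite prC prBr// prC [pr f h]prC. Qed.

Lemma rapid_mult phi f : order1 phi -> rapid f -> rapid (mult phi f).
Proof.
move=> hp [cf df]; have [C3 h3] := df 3; split; first exact: ccont_mult h3.
move=> m; have [C hC] := df m.+1; exists C => k.
rewrite (fc_mult _ hp h3) cabsM cabs_real.
have -> : C * (lam R k) ^- m = lam R k * (C * (lam R k) ^- m.+1).
  by rewrite exprSr invfM [lam R k * _]mulrC -!mulrA mulVf ?mulr1 ?lam_neq0.
by apply: ler_pM; rewrite ?cabs_ge0.
Qed.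

Lemma pr_mult phi f h : order1 phi -> rapid f -> ccont h ->
  pr h (mult phi f) = zser (fun k => (phi k)%:C * (fc h (- k) * fc f k)).
Proof. by move=> hp [_ /(_ 3)[C df]] ch; exact: avg_mult df ch. Qed.

Lemma fc_multr phi f k : order1 phi -> rapid f ->
  fc (mult phi f) k = (phi k)%:C * fc f k.
Proof. by move=> hp [_ /(_ 3)[C df]]; exact: fc_mult df. Qed.

Lemma decay_bounded m C f k : decay m C f -> cabs (fc f k) <= C.
Proof.
move=> df; rewrite (le_trans (df k))// -[leRHS]mulr1.
rewrite ler_wpM2l ?(decay_ge0 df)//.
by rewrite invf_le1 ?exprn_gt0 ?lam_gt0// exprn_ege1 ?lam_ge1.
Qed.

Lemma dominated_pair phi f h : order1 phi -> rapid f -> rapid h ->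
  exists C, dominated C (fun k => (phi k)%:C * (fc h (- k) * fc f k)).
Proof.
move=> hp [_ /(_ 3)[C df]] [_ /(_ 0)[B dh]]; exists (B * C) => k.
rewrite 2!cabsM cabs_real.
have -> : B * C * wgt R k = lam R k * (B * (C * (lam R k) ^- 3)).
  by rewrite /wgt; field; rewrite lam_neq0.
apply: ler_pM; rewrite ?mulr_ge0 ?cabs_ge0//.
by apply: ler_pM; rewrite ?cabs_ge0// (decay_bounded _ dh).
Qed.

(** Reflecting the summation index exchanges the coefficients of [f] and [h], while an even symbol
    stays in place. *)
Lemma pr_mult_sym phi f h : order1 phi -> even phi -> rapid f -> rapid h ->
  pr h (mult phi f) = pr f (mult phi h).
Proof.
move=> hp ep rf rh.
rewrite (pr_mult hp rf (rapid_ccont rh)) (pr_mult hp rh (rapid_ccont rf)).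
have [C dC] := dominated_pair hp rf rh.
rewrite -(zser_opp dC); apply: eq_zser => k.
by rewrite ep opprK [fc h k * _]mulrC.
Qed.

(** The second factor is by definition the sum of a series, so coefficient [p] of the product is the
    convolution sum given by [pr_mult]. *)
Lemma rapidM_mult phi f g : order1 phi -> rapid f -> rapid g ->
  rapid (fun t => f t * mult phi g t).
Proof.
move=> hp rf rg; have [cf df] := rf; have [cg dg] := rg.
split; first by apply: ccontM => //; exact: rapid_ccont (rapid_mult hp rg).
(* Of the [m + 3] orders of decay of [g], [m] pay for shifting the coefficients of [f], one for
   [phi], and two for summability. *)
move=> m; have [Cf hf] := df m; have [Cg hg] := dg (m + 3)%N.
have Cf0 := decay_ge0 hf; have Cg0 := decay_ge0 hg.
exists (2 * (Cg * Cf * 2 ^+ m) * wtot R) => p.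
rewrite /fc; under eq_fun do rewrite mulrA.
rewrite -/(pr (fun t => expi (- p) t * f t) _) pr_mult//; last first.
  by apply: ccontM => //; exact: ccont_expi.
pose D := Cg * Cf * 2 ^+ m * (lam R p) ^- m.
suff dD : dominated D (fun k => (phi k)%:C *
    (fc (fun t => expi (- p) t * f t) (- k) * fc g k)).
  have -> : 2 * (Cg * Cf * 2 ^+ m) * wtot R * lam R p ^- m = 2 * D * wtot R.
    by rewrite /D; ring.
  exact: cabs_zser dD.
move=> k; rewrite fc_expiM 2!cabsM cabs_real.
have l0 := lam_neq0 R k.
have -> : D * wgt R k = lam R k *
   ((Cf * ((2 * lam R k) ^+ m * (lam R p) ^- m)) * (Cg * (lam R k) ^- (m + 3))).
  have A0 : lam R k ^+ m != 0 by rewrite expf_neq0.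
  have B0 : lam R p ^+ m != 0 by rewrite expf_neq0 ?lam_neq0.
  rewrite /D /wgt exprMn exprD; move: (lam R k) l0 => x x0 in A0 *.
  move: (x ^+ m) (lam R p ^+ m) A0 B0 (2 ^+ m) => A B A0 B0 c; field.
  by rewrite A0 B0 x0.
apply: ler_pM; rewrite ?mulr_ge0 ?cabs_ge0//.
apply: ler_pM; rewrite ?cabs_ge0//.
rewrite (le_trans (hf _))// ler_wpM2l//.
by rewrite (_ : - k - - p = p - k) ?lamVX_le// opprK addrC.
Qed.

Lemma rapidM_multl phi f g : order1 phi -> rapid f -> rapid g ->
  rapid (fun t => mult phi f t * g t).
Proof.
move=> hp rf rg; under eq_fun do rewrite mulrC; exact: rapidM_mult.
Qed.

Lemma mult_expi phi l t : mult phi (@expi R l) t = (phi l)%:C * expi l t.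
Proof.
rewrite -[RHS](zser_single l); apply: eq_zser => k; rewrite fc_expi.
by case: eqP => [->|_]; rewrite ?mulr1 ?mulr0.
Qed.

Lemma multD phi f g t : order1 phi -> rapid f -> rapid g ->
  mult phi (fun t => f t + g t) t = mult phi f t + mult phi g t.
Proof.
move=> hp [cf /(_ 3)[C df]] [cg /(_ 3)[D dg]].
rewrite /mult -(zserD (dominated_mult_expi t hp df) (dominated_mult_expi t hp dg)).
by apply: eq_zser => k; rewrite fcD// !mulrDr.
Qed.

Lemma multZ phi c f t : order1 phi -> rapid f ->
  mult phi (fun t => c * f t) t = c * mult phi f t.
Proof.
move=> hp [cf /(_ 3)[C df]].
rewrite /mult -(zserZ _ (dominated_mult_expi t hp df)).
by apply: eq_zser => k; rewrite fcZ//; ring.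
Qed.

Lemma mult_sum phi (I : Type) (s : seq I) (F : I -> R -> R[i]) t :
  order1 phi -> (forall i, rapid (F i)) ->
  mult phi (fun t => \sum_(i <- s) F i t) t = \sum_(i <- s) mult phi (F i) t.
Proof.
move=> hp hF; elim: s => [|i s ih].
  have -> : (fun t : R => \sum_(i <- [::]) F i t) = (fun t => 0 * expi 0 t).
    by apply/funext => r; rewrite big_nil mul0r.
  by rewrite multZ ?mul0r ?big_nil//; exact: rapid_expi.
under eq_fun do rewrite big_cons.
by rewrite multD ?big_cons ?ih//; exact: rapid_sum.
Qed.

End Multipliers.
(* Otherwise unification unfolds products down to Lebesgue integrals. *)
Opaque pr mult fc zser avg.

(** * The connection form in scalar components *)

Section ConnectionSymbol.
Variable R : realType.
Implicit Types (f g h u v w : R -> R[i]).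

Local Notation lam := (lam R).

Definition rlam (k : int) : R := (lam k)^-1.

Lemma order1_lam : order1 lam.
Proof. by move=> k; rewrite ger0_norm// ltW// lam_gt0. Qed.

Lemma order1_rlam : order1 rlam.
Proof.
move=> k; rewrite /rlam ger0_norm; last by rewrite invr_ge0 ltW// lam_gt0.
by apply: (@le_trans _ _ 1); rewrite ?lam_ge1// invf_le1 ?lam_gt0 ?lam_ge1.
Qed.

Lemma even_lam : even lam. Proof. exact: lamN. Qed.
Lemma even_rlam : even rlam. Proof. by move=> k; rewrite /rlam lamN. Qed.

Local Notation Q := (mult lam).
Local Notation P := (mult rlam).

Lemma pr_expand (c : R[i]) (x1 x2 x3 y1 y2 y3 : R -> R[i]) :
  ccont x1 -> ccont x2 -> ccont x3 -> ccont y1 -> ccont y2 -> ccont y3 ->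
  pr (fun t => c * x1 t + x2 t - x3 t) (fun t => y1 t + c * y2 t - y3 t) =
  c * pr x1 y1 + c ^+ 2 * pr x1 y2 - c * pr x1 y3
  + pr x2 y1 + c * pr x2 y2 - pr x2 y3
  - pr x3 y1 - c * pr x3 y2 + pr x3 y3.
Proof.
move=> cx1 cx2 cx3 cy1 cy2 cy3.
have cc := @ccont_cst R c.
have cl : ccont (fun t => c * x1 t) by exact: ccontM.
have cr : ccont (fun t => c * y2 t) by exact: ccontM.
have crr : ccont (fun t => y1 t + c * y2 t - y3 t).
  by apply: ccontB => //; exact: ccontD.
have right x : ccont x -> pr x (fun t => y1 t + c * y2 t - y3 t) =
    pr x y1 + c * pr x y2 - pr x y3.
  move=> cx; rewrite prBr ?prDr ?prZr//; exact: ccontD.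
rewrite prBl ?prDl ?prZl//; last exact: ccontD.
by rewrite !right//; ring.
Qed.

(** Eight equations for nine terms: two terms with the same coefficient are compared only through
    their sum, since term by term they match crosswise. *)
Lemma pr_expand_swap c (x1 x2 x3 y1 y2 y3 : R -> R[i])
    (z1 z2 z3 w1 w2 w3 : R -> R[i]) :
  ccont x1 -> ccont x2 -> ccont x3 -> ccont y1 -> ccont y2 -> ccont y3 ->
  ccont z1 -> ccont z2 -> ccont z3 -> ccont w1 -> ccont w2 -> ccont w3 ->
  pr x1 y1 = pr z1 w1 -> pr x1 y2 = pr z1 w2 -> pr x1 y3 = pr z3 w2 ->
  pr x2 y1 = pr z2 w1 -> pr x2 y2 = pr z2 w2 ->
  pr x2 y3 + pr x3 y1 = pr z2 w3 + pr z3 w1 ->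
  pr x3 y2 = pr z1 w3 -> pr x3 y3 = pr z3 w3 ->
  pr (fun t => c * x1 t + x2 t - x3 t) (fun t => y1 t + c * y2 t - y3 t) =
  pr (fun t => c * z1 t + z2 t - z3 t) (fun t => w1 t + c * w2 t - w3 t).
Proof.
move=> cx1 cx2 cx3 cy1 cy2 cy3 cz1 cz2 cz3 cw1 cw2 cw3 e11 e12 e13 e21 e22 e e32 e33.
rewrite (pr_expand c cx1 cx2 cx3 cy1 cy2 cy3) (pr_expand c cz1 cz2 cz3 cw1 cw2 cw3).
rewrite e11 e12 e13 e21 e22 e32 e33.
move/eqP: e; rewrite -subr_eq => /eqP <-; ring.
Qed.

(* [symB k v / 2] is [stheta v e_k], and pairing [stheta u w] with [e_(-k)]
   amounts to pairing [w] with [symA k u / (2 lam k)]. *)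
Definition symA k u t : R[i] :=
  (lam k)%:C * (expi (- k) t * u t) + Q (fun s => expi (- k) s * u s) t
  - expi (- k) t * Q u t.

Definition symB k v t : R[i] :=
  expi k t * v t + (lam k)%:C * P (fun s => expi k s * v s) t
  - P (fun s => expi k s * Q v s) t.

(** The weights [lam] and [rlam] cancel on coefficients inside the pairing. The factor [1%:C]
    presents the result as the series of the symbol 1, the form that [dominated_pair] handles. *)
Lemma pr_QP f g : rapid f -> rapid g ->
  pr (Q f) (P g) = zser (fun k => 1%:C * (fc f (- k) * fc g k)).
Proof.
move=> rf rg; rewrite (pr_mult order1_rlam rg); last first.
  exact: rapid_ccont (rapid_mult order1_lam rf).
apply: eq_zser => k; rewrite (fc_multr _ order1_lam rf) lamN.
by rewrite -mulrA mulrA -rmorphM /= /rlam mulVf ?lam_neq0.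
Qed.

Lemma order1_one : order1 (fun=> 1 : R).
Proof. by move=> k; rewrite normr1 lam_ge1. Qed.

Lemma pr_QP_sym f g : rapid f -> rapid g -> pr (Q f) (P g) = pr (Q g) (P f).
Proof.
move=> rf rg; have [C dC] := dominated_pair order1_one rg rf.
apply: (etrans (pr_QP rf rg)); apply: (etrans _ (esym (pr_QP rg rf))).
apply: (etrans (esym (zser_opp dC))); apply: eq_zser => p.
by rewrite opprK [fc f p * _]mulrC.
Qed.

(** After [Q] and [P] cancel, the two exponentials shift both coefficient sequences by [k]
    compatibly, and shift invariance of the series removes [k]. *)
Lemma pr_QP_shift k u v : rapid u -> rapid v ->
  pr (Q (fun s => expi (- k) s * u s)) (P (fun s => expi k s * Q v s)) =
  pr u (Q v).
Proof.
move=> ru rv; have rQv := rapid_mult order1_lam rv.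
rewrite (pr_QP (rapid_expiM _ ru) (rapid_expiM _ rQv)).
rewrite (pr_mult order1_lam rv (rapid_ccont ru)).
have [C dC] := dominated_pair order1_lam rv ru.
rewrite -(zser_shift (- k) dC); apply: eq_zser => p.
rewrite !fc_expiM (fc_multr _ order1_lam rv) rmorph1 mul1r mulrCA.
by rewrite opprD.
Qed.

Lemma pr_expi k f g : pr (fun t => expi (- k) t * f t)
  (fun t => expi k t * g t) = pr f g.
Proof.
congr avg; apply/funext => t; rewrite mulrACA -expiD addNr expi0.
by rewrite mul1r.
Qed.

(** Here [a], [a'], [b], [b'] stand for e_(-k) u, e_(-k) Q u, e_k v, e_k Q v. The four cross terms
    then share the value [x], which is [pr u (Q v)]. *)
Lemma pr_sym_swap_abstract c x (a a' b b' : R -> R[i]) :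
  rapid a -> rapid a' -> rapid b -> rapid b' ->
  pr (Q a) (P b') = x -> pr (Q b) (P a') = x -> pr a' b = x -> pr b' a = x ->
  pr (fun t => c * a t + Q a t - a' t) (fun t => b t + c * P b t - P b' t) =
  pr (fun t => c * b t + Q b t - b' t) (fun t => a t + c * P a t - P a' t).
Proof.
move=> ra ra' rb rb' e1 e2 e3 e4.
have cQ f : rapid f -> ccont (Q f).
  by move=> rf; exact: rapid_ccont (rapid_mult order1_lam rf).
have cP f : rapid f -> ccont (P f).
  by move=> rf; exact: rapid_ccont (rapid_mult order1_rlam rf).
have Pswap f g (rf : rapid f) (rg : rapid g) :=
  pr_mult_sym order1_rlam even_rlam rf rg.
have Qswap := pr_mult_sym order1_lam even_lam ra rb.
apply: (pr_expand_swap c (rapid_ccont ra) (cQ _ ra) (rapid_ccont ra')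
  (rapid_ccont rb) (cP _ rb) (cP _ rb')
  (rapid_ccont rb) (cQ _ rb) (rapid_ccont rb')
  (rapid_ccont ra) (cP _ ra) (cP _ ra')).
- exact: prC.
- exact: Pswap.
- exact: Pswap.
- exact: (etrans (prC _ _) (etrans Qswap (prC _ _))).
- exact: pr_QP_sym.
- exact: (etrans (congr2 +%R e1 e3) (esym (congr2 +%R e2 e4))).
- exact: Pswap.
- exact: Pswap.
Qed.

(** Formally [symA k u] is [Q (symB (- k) u)], and the claim is self-adjointness of [Q]. The
    cancellation of [Q] against [P] behind this is available inside pairings, hence the expansion
    into products. *)
Lemma pr_sym_swap k u v : rapid u -> rapid v ->
  pr (symA k u) (symB k v) = pr (symA (- k) v) (symB (- k) u).
Proof.
move=> ru rv.
have rQu := rapid_mult order1_lam ru.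
have rQv := rapid_mult order1_lam rv.
have -> : symA (- k) v = (fun t => (lam k)%:C * (expi k t * v t) +
    Q (fun s => expi k s * v s) t - expi k t * Q v t).
  by rewrite /symA opprK lamN.
have -> : symB (- k) u = (fun t => expi (- k) t * u t +
    (lam k)%:C * P (fun s => expi (- k) s * u s) t -
    P (fun s => expi (- k) s * Q u s) t).
  by rewrite /symB lamN.
have e : pr v (Q u) = pr u (Q v).
  exact: pr_mult_sym order1_lam even_lam ru rv.
have e2 := pr_QP_shift (- k) rv ru; rewrite opprK in e2.
have e3 := etrans (pr_expi k (Q u) v) (etrans (prC _ _) e).
have e4 := etrans (prC _ _) (pr_expi k u (Q v)).
exact: (pr_sym_swap_abstract (lam k)%:C (rapid_expiM _ ru) (rapid_expiM _ rQu)
  (rapid_expiM _ rv) (rapid_expiM _ rQv) (pr_QP_shift k ru rv)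
  (etrans e2 e) e3 e4).
Qed.

End ConnectionSymbol.

(** * Diagonal coefficients of the scalar connection form and their growth *)

Section ScalarConnection.
Variable R : realType.
Implicit Types (f g h u v w : R -> R[i]).

Local Notation lam := (lam R).
Local Notation rlam := (rlam R).
Local Notation Q := (mult lam).
Local Notation P := (mult rlam).

Let rQ f : rapid f -> rapid (Q f).
Proof. exact: rapid_mult (@order1_lam R). Qed.

Let rP f : rapid f -> rapid (P f).
Proof. exact: rapid_mult (@order1_rlam R). Qed.

(* The coefficient of [e_l (x) e_i] in [theta0 2^-1 u f] when [u] and [f] are
   the components of the loops along [e_l] and [e_i]. *)
Definition stheta u f : R -> R[i] := fun t =>
  2^-1 * (u t * f t + P (fun s => u s * Q f s) t - P (fun s => Q u s * f s) t).

Lemma rapid_uQ u f : rapid u -> rapid f -> rapid (fun t => u t * Q f t).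
Proof. by move=> ru rf; exact: rapidM_mult (@order1_lam R) ru rf. Qed.

Lemma rapid_Qu u f : rapid u -> rapid f -> rapid (fun t => Q u t * f t).
Proof. by move=> ru rf; exact: rapidM_multl (@order1_lam R) ru rf. Qed.

Lemma ccont_stheta u f : rapid u -> rapid f -> ccont (stheta u f).
Proof.
move=> ru rf; apply: ccontM; first exact: ccont_cst.
have c1 := ccontM (rapid_ccont ru) (rapid_ccont rf).
have c2 := rapid_ccont (rP (rapid_uQ ru rf)).
have c3 := rapid_ccont (rP (rapid_Qu ru rf)).
exact: ccontB (ccontD c1 c2) c3.
Qed.

Lemma stheta_expi k v : rapid v ->
  stheta v (expi k) = (fun t => 2^-1 * symB k v t).
Proof.
move=> rv; apply/funext => t.
have e2 : (fun s => v s * Q (expi k) s) =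
    (fun s => (lam k)%:C * (expi k s * v s)).
  by apply/funext => s; rewrite mult_expi mulrC mulrA.
have e3 : (fun s => Q v s * expi k s) = (fun s => expi k s * Q v s).
  by apply/funext => s; exact: mulrC.
rewrite /stheta e2 e3 (multZ _ _ (@order1_rlam R) (rapid_expiM k rv)).
by rewrite (mulrC (v t)).
Qed.

Lemma rapid_symB k v : rapid v -> rapid (symB k v).
Proof.
move=> rv; have r1 := rapid_expiM k rv.
have r2 := rapidZ (lam k)%:C (rP r1).
have r3 := rP (rapid_expiM k (rQ rv)).
exact: rapidB (rapidD r1 r2) r3.
Qed.

(** Multiplying by [expi k] only shifts coefficients. For general [f] the product with [u] is merely
    shown continuous, in [ccont_stheta], which serves for the outer factor of [scurv]. *)
Lemma rapid_stheta_expi k v : rapid v -> rapid (stheta v (expi k)).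
Proof.
by move=> rv; rewrite (stheta_expi k rv); exact/rapidZ/rapid_symB.
Qed.

Lemma ccont_symA k u : rapid u -> ccont (symA k u).
Proof.
move=> ru; have r1 := rapid_expiM (- k) ru.
have r2 := rapidZ (lam k)%:C r1.
have r3 := rapid_expiM (- k) (rQ ru).
exact: rapid_ccont (rapidB (rapidD r2 (rQ r1)) r3).
Qed.

Lemma fcE f k : fc f k = pr (@expi R (- k)) f.
Proof. by []. Qed.

Lemma prA f g h : pr f (fun t => g t * h t) = pr (fun t => f t * g t) h.
Proof. by congr avg; apply/funext => t; rewrite mulrA. Qed.

(** Taking coefficient [k] turns [P] into the scalar [rlam k], and self-adjointness moves [Q] from
    [w] onto e_(-k) u. This is the transpose of [stheta u] applied to e_(-k). *)
Lemma fc_stheta u w k : rapid u -> rapid w ->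
  fc (stheta u w) k = 2^-1 * (rlam k)%:C * pr (symA k u) w.
Proof.
move=> ru rw; have cw := rapid_ccont rw.
have r1 := rapid_expiM (- k) ru; have rQ1 := rQ r1.
have rQu := rQ ru; have r3 := rapid_expiM (- k) rQu.
have r4 := rapid_uQ ru rw; have r5 := rapid_Qu ru rw.
have c1 := ccontM (rapid_ccont ru) cw.
have e1 : fc (fun t => u t * w t) k = pr (fun t => expi (- k) t * u t) w.
  exact: (etrans (fcE _ _) (prA _ _ _)).
have e2 : fc (fun t => u t * Q w t) k = pr (Q (fun t => expi (- k) t * u t)) w.
  apply: (etrans (etrans (fcE _ _) (prA _ _ _))).
  exact: (etrans (pr_mult_sym (@order1_lam R) (@even_lam R) rw r1) (prC _ _)).
have e3 : fc (fun t => Q u t * w t) k = pr (fun t => expi (- k) t * Q u t) w.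
  exact: (etrans (fcE _ _) (prA _ _ _)).
have cl := ccontM (ccont_cst (lam k)%:C) (rapid_ccont r1).
have eA : pr (symA k u) w = (lam k)%:C * pr (fun t => expi (- k) t * u t) w +
    pr (Q (fun t => expi (- k) t * u t)) w -
    pr (fun t => expi (- k) t * Q u t) w.
  apply: (etrans (prBl cw (ccontD cl (rapid_ccont rQ1)) (rapid_ccont r3))).
  apply: (congr2 (fun x y => x - y) _ erefl).
  apply: (etrans (prDl cw cl (rapid_ccont rQ1))).
  exact: (congr2 +%R (prZl _ cw (rapid_ccont r1)) erefl).
have c4 := rapid_ccont (rP r4); have c5 := rapid_ccont (rP r5).
have eT : fc (stheta u w) k = 2^-1 *
    (pr (fun t => expi (- k) t * u t) w
     + (rlam k)%:C * pr (Q (fun t => expi (- k) t * u t)) w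
     - (rlam k)%:C * pr (fun t => expi (- k) t * Q u t) w).
  apply: (etrans (fcZ _ _ (ccontB (ccontD c1 c4) c5))).
  apply: (congr1 ( *%R 2^-1)); apply: (etrans (fcB _ (ccontD c1 c4) c5)).
  apply: (congr2 (fun x y => x - y)).
    apply: (etrans (fcD _ c1 c4)); apply: (congr2 +%R e1).
    exact: (etrans (fc_multr _ (@order1_rlam R) r4) (congr1 ( *%R _) e2)).
  exact: (etrans (fc_multr _ (@order1_rlam R) r5) (congr1 ( *%R _) e3)).
have lr : (rlam k)%:C * (lam k)%:C = 1 :> R[i].
  by rewrite -rmorphM /= mulVf ?lam_neq0.
have alg (x y z r l : R[i]) : r * l = 1 ->
    2^-1 * (x + r * y - r * z) = 2^-1 * r * (l * x + y - z).
  move=> rl; have -> : 2^-1 * r * (l * x + y - z) =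
    2^-1 * (r * l * x + r * y - r * z) by ring.
  by rewrite rl mul1r.
apply: (etrans eT); apply: (etrans _ (congr1 ( *%R _) (esym eA))).
exact: alg lr.
Qed.

Definition scurv k u v : R[i] := fc (stheta u (stheta v (expi k))) k.

Lemma scurvE k u v : rapid u -> rapid v ->
  scurv k u v = 2^-1 * (rlam k)%:C * 2^-1 * pr (symA k u) (symB k v).
Proof.
move=> ru rv; rewrite /scurv (fc_stheta _ ru (rapid_stheta_expi k rv)).
rewrite -[RHS]mulrA; congr (_ * _).
rewrite -(prZr _ (ccont_symA k ru) (rapid_ccont (rapid_symB k rv))).
by rewrite (stheta_expi k rv).
Qed.

Lemma scurv_swap k u v : rapid u -> rapid v -> scurv (- k) u v = scurv k v u.
Proof.
move=> ru rv.
have e : pr (symA (- k) u) (symB (- k) v) = pr (symA k v) (symB k u).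
  by have := pr_sym_swap (- k) ru rv; rewrite (opprK k).
have er : rlam (- k) = rlam k by exact: even_rlam.
apply: (etrans (scurvE (- k) ru rv)); apply: (etrans _ (esym (scurvE k rv ru))).
by rewrite er; apply: (congr1 ( *%R _)).
Qed.

(** Coefficient [k] of e_k w is the mean of [w], and [Q] preserves means because [lam 0 = 1]; the
    three terms give half of 1 + 1 - 1/lam k. Only the linear dependence on the mean of [w] matters
    for the trace. *)
Lemma fc_stheta_expi w k : rapid w ->
  fc (stheta w (expi k)) k = (1 - 2^-1 * (rlam k)%:C) * fc w 0.
Proof.
move=> rw; have rk := rapid_expi R k; have rQw := rQ rw.
have r1 := rapid_expiM k rw; have r3 := rapid_expiM k rQw.
have rl := rapidZ (lam k)%:C (rP r1).
have e1 : fc (fun t => expi k t * w t) k = fc w 0.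
  exact: (etrans (fc_expiM _ _ _) (congr1 (fc w) (subrr k))).
have e2 : fc (fun t => expi k t * Q w t) k = fc w 0.
  apply: (etrans (fc_expiM _ _ _)); apply: (etrans (congr1 (fc (Q w)) (subrr k))).
  apply: (etrans (fc_multr 0 (@order1_lam R) rw)).
  by rewrite lam0 rmorph1 mul1r.
have eP1 := etrans (fc_multr k (@order1_rlam R) r1) (congr1 ( *%R _) e1).
have eP3 := etrans (fc_multr k (@order1_rlam R) r3) (congr1 ( *%R _) e2).
have cB := rapid_ccont (rapid_symB k rw); rewrite (stheta_expi k rw).
apply: (etrans (fcZ _ _ cB)).
have -> : fc (symB k w) k =
    fc w 0 + (lam k)%:C * ((rlam k)%:C * fc w 0) - (rlam k)%:C * fc w 0.
  apply: (etrans (fcB _ (rapid_ccont (rapidD r1 rl)) (rapid_ccont (rP r3)))).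
  apply: (congr2 (fun x y => x - y) _ eP3).
  apply: (etrans (fcD _ (rapid_ccont r1) (rapid_ccont rl))).
  apply: (congr2 +%R e1); apply: (etrans (fcZ _ _ (rapid_ccont (rP r1)))).
  exact: (congr1 ( *%R _) eP1).
rewrite mulrA -rmorphM /= mulfV ?lam_neq0// mul1r.
by field.
Qed.

(** The exponent 3 and the constant 8 come from shifting a function with [decay 3] by [k], which
    costs [(2 * lam k) ^+ 3]. In [symB_bound] an explicit factor [lam k] raises the exponent to
    4. *)
Lemma symA_bound u : rapid u -> exists2 C, 0 <= C &
  forall k t, `[0, 2 * pi]%classic t -> cabs (symA k u t) <= C * lam k ^+ 3.
Proof.
move=> ru; have [B hB] := ccont_bounded (rapid_ccont ru).
have [C hC] := ru.2 3; have C0 := decay_ge0 hC; have w0 := wtot_ge0 R.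
exists (`|B| + 2 * (C * 8) * wtot R + 2 * C * wtot R).
  by rewrite !addr_ge0// !mulr_ge0.
move=> k t tD; have l1 := lam_ge1 R k; have l0 := ltW (lam_gt0 R k).
have l3 : lam k <= lam k ^+ 3 by rewrite -[leLHS]expr1 ler_weXn2l.
have l3' : 1 <= lam k ^+ 3 by rewrite exprn_ege1.
rewrite /symA (le_trans (cabsB _ _))// mulrDl; apply: lerD; last first.
  rewrite cabsM cabs_expi mul1r.
  rewrite (le_trans (cabs_mult t (@order1_lam R) hC))// -[leLHS]mulr1.
  by rewrite ler_wpM2l// !mulr_ge0.
rewrite mulrDl (le_trans (cabsD _ _))//; apply: lerD.
  rewrite 2!cabsM cabs_expi mul1r cabs_real ger0_norm ?l0// [leRHS]mulrC.
  apply: ler_pM; rewrite ?cabs_ge0 ?l0//.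
  by rewrite (le_trans (hB t tD)) ?ler_norm.
have := cabs_mult t (@order1_lam R) (decay_expiM (- k) hC).
rewrite lamN exprMn => /le_trans; apply.
by rewrite le_eqVlt; apply/orP; left; apply/eqP; ring.
Qed.

Lemma symB_bound v : rapid v -> exists2 C, 0 <= C &
  forall k t, `[0, 2 * pi]%classic t -> cabs (symB k v t) <= C * lam k ^+ 4.
Proof.
move=> rv; have [B hB] := ccont_bounded (rapid_ccont rv).
have [C hC] := rv.2 3; have C0 := decay_ge0 hC; have w0 := wtot_ge0 R.
have [D hD] := (rQ rv).2 3; have D0 := decay_ge0 hD.
exists (`|B| + 2 * (C * 8) * wtot R + 2 * (D * 8) * wtot R).
  by rewrite !addr_ge0// !mulr_ge0.
move=> k t tD; have l1 := lam_ge1 R k; have l0 := ltW (lam_gt0 R k).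
have l4 : lam k ^+ 3 <= lam k ^+ 4 by rewrite ler_weXn2l.
have l4' : 1 <= lam k ^+ 4 by rewrite exprn_ege1.
rewrite /symB (le_trans (cabsB _ _))// mulrDl; apply: lerD; last first.
  have := cabs_mult t (@order1_rlam R) (decay_expiM k hD).
  rewrite exprMn => /le_trans; apply.
  have -> : 2 * (D * (2 ^+ 3 * lam k ^+ 3)) * wtot R =
    2 * (D * 8) * wtot R * lam k ^+ 3 by ring.
  by rewrite ler_wpM2l// !mulr_ge0.
rewrite mulrDl (le_trans (cabsD _ _))//; apply: lerD.
  rewrite cabsM cabs_expi mul1r -[leLHS]mulr1.
  apply: ler_pM; rewrite ?cabs_ge0//.
  by rewrite (le_trans (hB t tD)) ?ler_norm.
rewrite cabsM cabs_real (ger0_norm l0).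
have -> : 2 * (C * 8) * wtot R * lam k ^+ 4 =
  lam k * (2 * (C * (2 * lam k) ^+ 3) * wtot R) by ring.
apply: ler_wpM2l => //.
exact: cabs_mult (@order1_rlam R) (decay_expiM k hC).
Qed.

Lemma scurv_bound u v : rapid u -> rapid v ->
  exists C, forall k, cabs (scurv k u v) <= C * lam k ^+ 7.
Proof.
move=> ru rv; have [A A0 hA] := symA_bound ru; have [B B0 hB] := symB_bound rv.
exists (2 * (A * B)) => k; rewrite (scurvE k ru rv) cabsM.
have l7 : 0 <= lam k ^+ 7 by rewrite exprn_ge0// ltW// lam_gt0.
have c1 : cabs (2^-1 * (rlam k)%:C * 2^-1) <= 1.
  have -> : 2^-1 * (rlam k)%:C * 2^-1 = (2^-1 * rlam k * 2^-1)%:C :> R[i].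
    have h2 : 2^-1 = (2^-1)%:C :> R[i].
      by rewrite -[2 in LHS](rmorph_nat (real_complex R)) -fmorphV.
    by rewrite !rmorphM h2.
  rewrite cabs_real; have r0 : 0 <= rlam k by rewrite invr_ge0 ltW// lam_gt0.
  have r1 : rlam k <= 1 by rewrite invf_le1 ?lam_gt0// lam_ge1.
  rewrite ger0_norm ?mulr_ge0//; lra.
rewrite -[leRHS]mul1r; apply: ler_pM; rewrite ?cabs_ge0// -mulrA.
have cA := ccont_symA k ru; have cB := rapid_ccont (rapid_symB k rv).
apply: (cabs_avg (ccontM cA cB)) => t tD; rewrite cabsM.
have -> : A * B * lam k ^+ 7 = (A * lam k ^+ 3) * (B * lam k ^+ 4) by ring.
by apply: ler_pM; rewrite ?cabs_ge0 ?hA ?hB.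
Qed.

End ScalarConnection.
Opaque stheta scurv.

(** * Decay of the Fourier coefficients of smooth periodic functions *)

Section SmoothRapid.
Variable R : realType.
Implicit Types f : R -> R[i].

(** Equality of the endpoint values at each order is what cancels the boundary terms in repeated
    integration by parts. *)
Fixpoint periodicCk (m : nat) f : Prop :=
  [/\ ccont f, f (2 * pi) = f 0 &
      if m is m'.+1 then exists2 df, cderiv f df & periodicCk m' df else True].

Lemma fc_cderiv f df k : cderiv f df -> ccont f -> ccont df ->
  f (2 * pi) = f 0 -> fc df k = (0 +i* k%:~R) * fc f k.
Proof.
move=> fdf cf cdf per.
have ce := @ccont_expi R (- k).
have c1 : ccont (fun t => ((0 +i* (- k)%:~R) * expi (- k) t) * f t).
  by apply: ccontM => //; apply: ccontM => //; exact: ccont_cst.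
have c2 : ccont (fun t => expi (- k) t * df t) by exact: ccontM.
have := avg_cderiv (cderivM (cderiv_expi (- k)) fdf) (ccontD c1 c2).
rewrite per expi_periodic => /(_ erefl); rewrite (avgD c1 c2).
have -> : avg (fun t => ((0 +i* (- k)%:~R) * expi (- k) t) * f t) =
    (0 +i* (- k)%:~R) * fc f k.
  rewrite -(avgZ _ (ccontM ce cf)); congr avg; apply/funext => t.
  by rewrite mulrA.
move/eqP; rewrite addrC addr_eq0 => /eqP e; rewrite [LHS]e -mulNr; congr (_ * _).
by apply/eqP; rewrite eq_complex /= oppr0 intrN opprK !eqxx.
Qed.

Lemma periodicCk_ccont m f : periodicCk m f -> ccont f.
Proof. by case: m => [|m] []. Qed.

Lemma periodicCk_decay m f : periodicCk m f -> exists C, decay m C f.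
Proof.
elim: m f => [|m ih] f.
  move=> [cf _ _]; have [B hB] := ccont_bounded cf; exists (2 * B) => k.
  rewrite expr0 invr1 mulr1; apply: cabs_avg => [|t tD].
    by apply: ccontM => //; exact: ccont_expi.
  by rewrite cabsM cabs_expi mul1r hB.
move=> [cf per [df fdf pdf]]; have [C hC] := ih _ pdf.
have [B hB] := ccont_bounded cf.
have hfc k : cabs (fc f k) <= 2 * `|B|.
  apply: cabs_avg => [|t tD]; first by apply: ccontM => //; exact: ccont_expi.
  by rewrite cabsM cabs_expi mul1r (le_trans (hB t tD))// ler_norm.
(* [C] serves for [k != 0], where one integration by parts gains a factor [lam k]; the term with [B]
   covers [k = 0]. *)
exists (C + 2 * `|B|) => k; have C0 := decay_ge0 hC.
have [->|k0] := eqVneq k 0.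
  by rewrite lam0 expr1n invr1 mulr1 (le_trans (hfc 0))// lerDr.
have lk : lam R k = `|k%:~R| by rewrite /lam (negbTE k0).
rewrite exprS invfM mulrCA -ler_pdivrMl ?invr_gt0 ?lam_gt0// invrK.
have -> : lam R k * cabs (fc f k) = cabs (fc df k).
  rewrite (fc_cderiv k fdf cf (periodicCk_ccont pdf) per) cabsM; congr (_ * _).
  by rewrite lk /cabs /= expr0n /= add0r sqrtr_sqr.
rewrite (le_trans (hC k))// ler_wpM2r ?lerDl ?mulr_ge0//.
by rewrite ltW// lamX_gt0.
Qed.

Lemma periodicCk_rapid f : (forall m, periodicCk m f) -> rapid f.
Proof.
move=> h; split; first exact: periodicCk_ccont (h 0%N).
by move=> m; exact: periodicCk_decay.
Qed.

End SmoothRapid.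

(** * Smooth functions and the bracket of Lie(G) *)

Section CkFunctions.
Variables (R : realType) (V : normedModType R).
Implicit Types (W : normedModType R) (D : set V) (k : nat).

Lemma Ck_continuous W k D (f : V -> W) : Ck k D f ->
  forall x, D x -> {for x, continuous f}.
Proof. by case: k => [|k] []. Qed.

Lemma Ck_le W k D (f : V -> W) : Ck k.+1 D f -> Ck k D f.
Proof.
elim: k f => [|k ih] f [cf h]; first by split.
by split => // v; have [dv Cv] := h v; split => //; exact: ih.
Qed.

(** Openness turns equality on [D] into equality near each of its points, so derivative formulas
    valid only on [D] may replace ['D_v f] in the inductions below. *)
Lemma eq_Ck W k D (f g : V -> W) : open D -> (forall x, D x -> f x = g x) ->
  Ck k D f -> Ck k D g.
Proof.
move=> oD; elim: k f g => [|k ih] f g fg Cf.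
  split=> // x Dx; suff : g @ x --> f x by rewrite (fg x Dx).
  apply: cvg_trans (Ck_continuous Cf Dx); apply: near_eq_cvg.
  by near=> y; apply: fg; near: y; exact: open_nbhs_nbhs.
split; first exact: (Ck_continuous (ih _ _ fg (Ck_le Cf))).
have nfg x (Dx : D x) : \forall y \near x, f y = g y.
  by near=> y; apply: fg; near: y; exact: open_nbhs_nbhs.
move=> v; have [dv Cv] := Cf.2 v; split.
  by move=> x Dx; exact: near_eq_derivable (nfg x Dx) (dv x Dx).
by apply: ih Cv => x Dx; exact: near_eq_derive (nfg x Dx).
Unshelve. all: by end_near. Qed.

Lemma Ck_cst W k D (c : W) : Ck k D (fun=> c).
Proof.
elim: k c => [|k ih] c; split=> //.
- by move=> x _; exact: cvg_cst.
- by move=> x _; exact: cvg_cst.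
- move=> v; split=> [x _|]; first exact: derivable_cst.
  have -> : 'D_v (fun=> c) = (fun=> 0) :> (V -> W).
    by apply/funext => x; exact: derive_cst.
  exact: ih.
Qed.

Lemma CkD W k D (f g : V -> W) : open D -> Ck k D f -> Ck k D g ->
  Ck k D (fun x => f x + g x).
Proof.
move=> oD; elim: k f g => [|k ih] f g Cf Cg.
  split=> // x Dx.
  by apply: cvgD; [exact: (Ck_continuous Cf)|exact: (Ck_continuous Cg)].
split; first exact: (Ck_continuous (ih _ _ (Ck_le Cf) (Ck_le Cg))).
move=> v; have [df C'f] := Cf.2 v; have [dg C'g] := Cg.2 v; split.
  by move=> x Dx; apply: derivableD; [exact: df|exact: dg].
apply: eq_Ck (ih _ _ C'f C'g) => // x Dx.
by apply/esym/deriveD; [exact: df|exact: dg].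
Qed.

Lemma CkM k D (f g : V -> R) : open D -> Ck k D f -> Ck k D g ->
  Ck k D (fun x => f x * g x).
Proof.
move=> oD; elim: k f g => [|k ih] f g Cf Cg.
  split=> // x Dx.
  by apply: cvgM; [exact: (Ck_continuous Cf)|exact: (Ck_continuous Cg)].
split; first exact: (Ck_continuous (ih _ _ (Ck_le Cf) (Ck_le Cg))).
move=> v; have [df C'f] := Cf.2 v; have [dg C'g] := Cg.2 v; split.
  by move=> x Dx; apply: derivableM; [exact: df|exact: dg].
have h := CkD oD (ih _ _ (Ck_le Cf) C'g) (ih _ _ (Ck_le Cg) C'f).
apply: eq_Ck h => // x Dx.
by apply/esym/deriveM; [exact: df|exact: dg].
Qed.

Lemma CkZ k D (c : R) (f : V -> R) : open D -> Ck k D f ->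
  Ck k D (fun x => c * f x).
Proof. by move=> oD; apply: CkM => //; exact: Ck_cst. Qed.

Lemma Ck_sum W k D (I : Type) (s : seq I) (F : I -> V -> W) : open D ->
  (forall i, Ck k D (F i)) -> Ck k D (fun x => \sum_(i <- s) F i x).
Proof.
move=> oD h; elim: s => [|i s ih].
  by under eq_fun do rewrite big_nil; exact: Ck_cst.
by under eq_fun do rewrite big_cons; exact: CkD.
Qed.

Lemma continuous_rowP n (F : V -> 'rV[R]_n) x :
  {for x, continuous F} <-> forall j, {for x, continuous (fun y => F y ord0 j)}.
Proof.
split=> [cF j|h].
  apply: (@continuous_comp _ _ _ F (fun M : 'rV[R]_n => M ord0 j)) => //.
  exact: coord_continuous.
apply/cvgrPdist_le => e e0.
have hj j : \forall y \near x, `|F x ord0 j - F y ord0 j| <= e.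
  by have /cvgrPdist_le/(_ _ e0) := h j.
have : \forall y \near x, forall j, `|F x ord0 j - F y ord0 j| <= e.
  exact: filter_forall.
apply: filterS => y hy.
rewrite /Num.Def.normr /= mx_normrE (bigmax_le _ (ltW e0))//= => -[i j] _.
by rewrite !mxE !(ord1 i).
Qed.

Lemma Ck_rowP n k D (F : V -> 'rV[R]_n) : open D ->
  Ck k D F <-> forall j, Ck k D (fun x => F x ord0 j).
Proof.
move=> oD; elim: k F => [|k ih] F; split.
- by move=> [cF _] j; split=> // x Dx; apply/(continuous_rowP F x).1; exact: cF.
- move=> h; split=> // x Dx; apply/continuous_rowP => j; exact: (h j).1.
- move=> CF j; split; first exact: (Ck_continuous ((ih F).1 (Ck_le CF) j)).
  move=> v; have [dF CFv] := CF.2 v; split.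
    by move=> x Dx; exact: (derivable_mxP _ _ _).1 (dF x Dx) ord0 j.
  apply: eq_Ck ((ih _).1 CFv j) => // x Dx.
  by rewrite derive_mx ?mxE//; exact: dF.
- move=> h; split.
    by move=> x Dx; apply/continuous_rowP => j; exact: (h j).1.
  move=> v; have dF x (Dx : D x) : derivable F x v.
    by apply/derivable_mxP => i j; rewrite (ord1 i); exact: ((h j).2 v).1.
  split=> //; apply/ih => j; apply: eq_Ck ((h j).2 v).2 => // x Dx.
  by rewrite derive_mx ?mxE//; exact: dF.
Qed.

End CkFunctions.

(** * Lie algebra identities from commutators of derivations *)

Section LieBracket.
Variables (R : realType) (G : lieGroup R).
Local Notation n := (lie_dim G).
Implicit Types (f g : G -> R) (X Y : derivation G).

Lemma smooth_funD f g : smooth_fun f -> smooth_fun g ->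
  smooth_fun (fun p => f p + g p).
Proof.
move=> sf sg a Aa k; exact: (CkD (@cimg_open _ _ _ a) (sf a Aa k) (sg a Aa k)).
Qed.

Lemma smooth_funM f g : smooth_fun f -> smooth_fun g ->
  smooth_fun (fun p => f p * g p).
Proof.
move=> sf sg a Aa k; exact: (CkM (@cimg_open _ _ _ a) (sf a Aa k) (sg a Aa k)).
Qed.

Lemma smooth_fun_cst (c : R) : smooth_fun (fun _ : G => c).
Proof. by move=> a Aa k; exact: Ck_cst. Qed.

Lemma smooth_funZ (c : R) f : smooth_fun f -> smooth_fun (fun p => c * f p).
Proof. by move=> sf; apply: smooth_funM => //; exact: smooth_fun_cst. Qed.

Lemma smooth_fun_sum (I : Type) (s : seq I) (F : I -> G -> R) :
  (forall i, smooth_fun (F i)) -> smooth_fun (fun p => \sum_(i <- s) F i p).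
Proof.
move=> h; elim: s => [|i s ih].
  by under eq_fun do rewrite big_nil; exact: smooth_fun_cst.
by under eq_fun do rewrite big_cons; exact: smooth_funD.
Qed.

Definition commutator X Y : derivation G :=
  fun f p => X (Y f) p - Y (X f) p.

Section LIVF.
Variable X : derivation G.
Hypothesis hX : left_invariant_vf X.

Lemma livfD f g p : smooth_fun f -> smooth_fun g ->
  X (fun q => f q + g q) p = X f p + X g p.
Proof.
move=> sf sg; have := livf_linear hX 1 sf sg => /(congr1 (@^~ p)) /=.
by under eq_fun do rewrite mul1r; rewrite mul1r.
Qed.

Lemma livf0 p : X (fun=> 0) p = 0.
Proof.
have s0 := @smooth_fun_cst 0; have := livfD p s0 s0.
under eq_fun do rewrite addr0.
by move=> /eqP; rewrite -subr_eq0 opprD addrA subrr sub0r oppr_eq0 => /eqP.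
Qed.

Lemma livfZ c f p : smooth_fun f -> X (fun q => c * f q) p = c * X f p.
Proof.
move=> sf; have := livf_linear hX c sf (smooth_fun_cst 0).
move=> /(congr1 (@^~ p)) /=; rewrite livf0 addr0 => <-.
by congr (X _ p); apply/funext => q; rewrite addr0.
Qed.

Lemma livfB f g p : smooth_fun f -> smooth_fun g ->
  X (fun q => f q - g q) p = X f p - X g p.
Proof.
move=> sf sg; have -> : (fun q => f q - g q) = (fun q => f q + -1 * g q).
  by apply/funext => q; rewrite mulN1r.
by rewrite livfD ?livfZ ?mulN1r//; exact: smooth_funZ.
Qed.

End LIVF.

Lemma smooth_funB f g : smooth_fun f -> smooth_fun g ->
  smooth_fun (fun p => f p - g p).
Proof.
move=> sf sg; apply: smooth_funD => //.
by under eq_fun do rewrite -mulN1r; exact: smooth_funZ.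
Qed.

(** Second-order cross terms cancel in the Leibniz rule. This makes the choice of coordinates inside
    [br] meaningful. *)
Lemma commutator_livf X Y : left_invariant_vf X -> left_invariant_vf Y ->
  left_invariant_vf (commutator X Y).
Proof.
move=> hX hY; have sX := livf_smooth hX; have sY := livf_smooth hY; split.
- by move=> f sf; apply: smooth_funB; [exact/sX/sY|exact/sY/sX].
- move=> a f g sf sg; apply/funext => p; rewrite /commutator.
  rewrite (livf_linear hX)// (livf_linear hY)//.
  rewrite (livf_linear hX) ?(livf_linear hY)//; do ?[exact: sX|exact: sY].
  ring.
- move=> f g sf sg; apply/funext => p; rewrite /commutator.
  rewrite (livf_leibniz hX)// (livf_leibniz hY)//.
  rewrite (livfD hX) ?(livfD hY); do ?by apply: smooth_funM => //;
    do ?[exact: sX|exact: sY].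
  rewrite !(livf_leibniz hX) ?(livf_leibniz hY)//; do ?[exact: sX|exact: sY].
  ring.
- move=> h f sf; apply/funext => p; rewrite /commutator.
  rewrite !(livf_invariant hX, livf_invariant hY)//; do ?[exact: sX|exact: sY].
Qed.

Variable E : 'I_n -> derivation G.
Hypothesis hE : lie_basis E.

Lemma vf_livf (x : 'rV[R]_n) : left_invariant_vf (vf E x).
Proof.
have hEi := hE.1; have sE i := livf_smooth (hEi i); split.
- move=> f sf; apply: smooth_fun_sum => i; exact/smooth_funZ/sE.
- move=> a f g sf sg; apply/funext => p; rewrite /vf mulr_sumr -big_split /=.
  by apply: eq_bigr => i _; rewrite (livf_linear (hEi i))//; ring.
- move=> f g sf sg; apply/funext => p; rewrite /vf mulr_sumr mulr_suml.
  rewrite -big_split /=.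
  by apply: eq_bigr => i _; rewrite (livf_leibniz (hEi i))//; ring.
- move=> h f sf; apply/funext => p.
  by apply: eq_bigr => i _; rewrite (livf_invariant (hEi i)).
Qed.

(** The existence half of [lie_basis] guarantees that [xget] does not return its default. *)
Lemma coordsP X f : left_invariant_vf X -> smooth_fun f ->
  X f = vf E (coords E X) f.
Proof.
move=> hX sf; have [x [hx _]] := hE.2 X hX.
have h : [set x | forall f, smooth_fun f -> X f = vf E x f] (coords E X).
  by apply: xgetPex; exists x.
exact: h.
Qed.

Lemma br_vf x y f p : smooth_fun f ->
  vf E (br E x y) f p = commutator (vf E x) (vf E y) f p.
Proof.
by move=> sf; rewrite -(coordsP (commutator_livf (vf_livf x) (vf_livf y)) sf).
Qed.

(** The uniqueness half of [lie_basis]: identities for [br] may be tested on smooth functions, where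
    they become identities between commutators. *)
Lemma vf_inj x y :
  (forall f p, smooth_fun f -> vf E x f p = vf E y f p) -> x = y.
Proof.
move=> h; have [z [_ uz]] := hE.2 _ (vf_livf x).
rewrite -(uz x)//; apply: uz => f sf; apply/funext => p; exact: h.
Qed.

Lemma vfD x y f p : vf E (x + y) f p = vf E x f p + vf E y f p.
Proof.
by rewrite /vf -big_split; apply: eq_bigr => i _; rewrite mxE mulrDl.
Qed.

Lemma vfZ a x f p : vf E (a *: x) f p = a * vf E x f p.
Proof.
by rewrite /vf mulr_sumr; apply: eq_bigr => i _; rewrite mxE mulrA.
Qed.

Let svf x f : smooth_fun f -> smooth_fun (vf E x f).
Proof. exact: livf_smooth (vf_livf x) f. Qed.

Lemma br_anti x y : br E x y = - br E y x.
Proof.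
apply: vf_inj => f p sf; rewrite -scaleN1r vfZ !br_vf// /commutator; ring.
Qed.

Lemma br_linearl a x y z : br E (a *: x + y) z = a *: br E x z + br E y z.
Proof.
apply: vf_inj => f p sf; rewrite vfD vfZ !br_vf// /commutator vfD vfZ.
have -> : vf E (a *: x + y) f = (fun q => a * vf E x f q + vf E y f q).
  by apply/funext => q; rewrite vfD vfZ.
rewrite (livf_linear (vf_livf z)); do ?exact: svf.
ring.
Qed.

Lemma br_jacobi x y z :
  br E (br E x y) z = br E x (br E y z) - br E y (br E x z).
Proof.
apply: vf_inj => f p sf; rewrite -scaleN1r vfD vfZ !br_vf// /commutator.
have h a b g : smooth_fun g -> vf E (br E a b) g =
    (fun q => vf E a (vf E b g) q - vf E b (vf E a g) q).
  by move=> sg; apply/funext => q; rewrite br_vf.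
rewrite !h//; do ?by [exact: svf|].
rewrite !(livfB (vf_livf _)); do ?[exact: svf|exact/svf/svf].
all: try exact: vf_livf.
ring.
Qed.

End LieBracket.

(** * Adjoint matrices and the complexified bracket *)

Section ComplexBracket.
Variables (R : realType) (G : lieGroup R) (E : 'I_(lie_dim G) -> derivation G).
Local Notation n := (lie_dim G).
Hypothesis hE : lie_basis E.

Definition adR (i : 'I_n) : 'M[R]_n :=
  \matrix_(j, l) br E (delta_mx ord0 i) (delta_mx ord0 j) ord0 l.

Definition adC (i : 'I_n) : 'M[R[i]]_n := map_mx (real_complex R) (adR i).

Lemma row_adR i j : row j (adR i) = br E (delta_mx ord0 i) (delta_mx ord0 j).
Proof. by apply/rowP => l; rewrite !mxE. Qed.

Lemma brCE x y : brC E x y = \sum_i x ord0 i *: (y *m adC i).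
Proof.
apply: eq_bigr => i _; rewrite mulmx_sum_row scaler_sumr.
apply: eq_bigr => j _; rewrite -scalerA; congr (_ *: (_ *: _)).
by rewrite -row_adR; apply/rowP => l; rewrite !mxE.
Qed.

Lemma br0l y : br E 0 y = 0.
Proof.
by have := br_linearl hE (-1) 0 0 y; rewrite !scaleN1r oppr0 addr0 addNr.
Qed.

Lemma br_suml (I : Type) (s : seq I) (c : I -> R) (x : I -> 'rV[R]_n) y :
  br E (\sum_(i <- s) c i *: x i) y = \sum_(i <- s) c i *: br E (x i) y.
Proof.
elim: s => [|i s ih]; first by rewrite !big_nil br0l.
by rewrite !big_cons br_linearl// ih.
Qed.

Lemma br_sumr (I : Type) (s : seq I) (c : I -> R) (x : I -> 'rV[R]_n) y :
  br E y (\sum_(i <- s) c i *: x i) = \sum_(i <- s) c i *: br E y (x i).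
Proof.
rewrite br_anti// br_suml -sumrN; apply: eq_bigr => i _.
by rewrite -scalerN -br_anti.
Qed.

Definition adM (x : 'rV[R]_n) : 'M[R]_n := \sum_i x ord0 i *: adR i.

Lemma mul_adM x y : y *m adM x = br E x y.
Proof.
rewrite {2}[x]row_sum_delta {2}[y]row_sum_delta br_suml mulmx_sumr.
apply: eq_bigr => i _; rewrite br_sumr -scalemxAr; congr (_ *: _).
by rewrite mulmx_sum_row; apply: eq_bigr => j _; rewrite row_adR.
Qed.

Lemma brC_real x y :
  brC E (map_mx (real_complex R) x) (map_mx (real_complex R) y) =
  map_mx (real_complex R) (br E x y).
Proof.
rewrite brCE -mul_adM map_mxM /= /adM raddf_sum /= mulmx_sumr.
apply: eq_bigr => i _; rewrite mxE map_mxZ /= -scalemxAr.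
by [].
Qed.

(** The Jacobi identity; products appear in reverse order because the matrices act on row vectors
    from the right. *)
Lemma adM_br x y : adM (br E x y) = adM y *m adM x - adM x *m adM y.
Proof.
apply/row_matrixP => i; rewrite !rowE mulmxBr !mulmxA !mul_adM.
exact: br_jacobi.
Qed.

Lemma trace_adC_br x y :
  \sum_i (real_complex R (br E x y ord0 i)) * \tr (adC i) = 0.
Proof.
have : \tr (adM (br E x y)) = 0.
  by rewrite adM_br raddfB /= mxtrace_mulC subrr.
rewrite /adM raddf_sum /= => /(congr1 (real_complex R)).
rewrite rmorph0 rmorph_sum /= => e; rewrite -[RHS]e.
apply: eq_bigr => i _; rewrite mxtraceZ rmorphM /=; congr (_ * _).
by rewrite /adC /mxtrace rmorph_sum; apply: eq_bigr => j _; rewrite mxE.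
Qed.

End ComplexBracket.

(** * Diagonal entries of the curvature *)

Section ModeExpansion.
Variables (R : realType) (G : lieGroup R) (E : 'I_(lie_dim G) -> derivation G).
Local Notation n := (lie_dim G).
Local Notation C := (R[i]).
Implicit Types (I : finType).

Local Notation lam := (lam R).
Local Notation rlam := (rlam R).
Local Notation Q := (mult lam).
Local Notation P := (mult rlam).

(** Separates variables: multipliers act on the scalar functions [f i] and the bracket on the
    constant vectors [z i], so [theta0] reduces to [stheta]. *)
Definition lcomb I m (f : I -> R -> C) (z : I -> 'rV[C]_m) : cloop R m :=
  fun t => \sum_i f i t *: z i.

Lemma lcombE I m (f : I -> R -> C) (z : I -> 'rV[C]_m) t j :
  lcomb f z t ord0 j = \sum_i z i ord0 j * f i t.
Proof.
by rewrite summxE; apply: eq_bigr => i _; rewrite mxE mulrC.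
Qed.

Lemma fcoef_lcomb I m (f : I -> R -> C) (z : I -> 'rV[C]_m) k :
  (forall i, ccont (f i)) -> fcoef (lcomb f z) k = \sum_i fc (f i) k *: z i.
Proof.
move=> cf; apply/rowP => j; rewrite fcoefE summxE.
have -> : (fun t => lcomb f z t ord0 j) = (fun t => \sum_i z i ord0 j * f i t).
  by apply/funext => t; rewrite lcombE.
rewrite fc_sum => [|i]; last by apply: ccontM => //; exact: ccont_cst.
by apply: eq_bigr => i _; rewrite fcZ// mxE mulrC.
Qed.

(** The index [j] witnesses that the dimension is positive; in dimension 0 every scalar would
    qualify as an eigenvalue. *)
Lemma eigenval_mode m (j : 'I_m) (T : operator R m) k (l : R) :
  (forall x, T (mode k x) = mode k (l%:C *: x)) -> eigenval T k = l.
Proof.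
move=> h; have : [set l : R | forall x, T (mode k x) = mode k (l%:C *: x)]
    (eigenval T k) by apply: xgetPex; exists l.
move=> /= /(_ (delta_mx ord0 j)); rewrite h.
move=> /(congr1 (fun X : cloop R m => X 0 ord0 j)).
rewrite /mode !mxE !eqxx !mulr1 /expi mulr0 cos0 sin0.
by rewrite -[_ +i* _]/(1 : C) !mul1r => /complexI.
Qed.

Lemma eigenval_Q0 m (j : 'I_m) k : eigenval (@Q0 R m) k = k%:~R ^+ 2.
Proof. by apply: (eigenval_mode j) => x; exact: Q0_mode. Qed.

Lemma modeE m k (x : 'rV[C]_m) t j : mode k x t ord0 j = x ord0 j * expi k t.
Proof. by rewrite mxE mulrC. Qed.

Lemma fcoef_mode m k l (x : 'rV[C]_m) :
  fcoef (mode k x) l = if l == k then x else 0.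
Proof.
apply/rowP => j; rewrite fcoefE.
have -> : (fun t => mode k x t ord0 j) = (fun t => x ord0 j * expi k t).
  by apply/funext => t; exact: modeE.
rewrite fcZ ?fc_expi; last exact: ccont_expi.
by case: eqP; rewrite ?mulr1 ?mulr0 ?mxE.
Qed.

Lemma eigenval_Q0P m (j : 'I_m) k :
  eigenval (@Q0P R m) k = if k == 0 then 1 else k%:~R ^+ 2.
Proof.
apply: (eigenval_mode j) => x; apply/funext => t.
rewrite /Q0P /P0 Q0_mode fcoef_mode eq_sym.
case: eqP => [->|_]; last by rewrite addr0.
rewrite expr0n /= scale0r /mode scaler0 add0r.
by rewrite expi0 rmorph1 !scale1r.
Qed.

(** Here the exponent 1/2 of the metric enters: it makes Q0^s an operator of order exactly 1. *)
Lemma powR_half k : (if k == 0 then 1 else k%:~R ^+ 2) `^ 2^-1 = lam k.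
Proof.
rewrite /lam; case: eqP => [_|_]; first by rewrite powR1.
by rewrite powR12_sqrt ?sqr_ge0// sqrtr_sqr.
Qed.

Lemma Q0pow_half m (X : cloop R m) t j :
  Q0pow 2^-1 X t ord0 j = Q (fun s => X s ord0 j) t.
Proof.
apply: (etrans (fcalcE _ _ _ _ _)).
apply: (congr1 (fun phi => mult phi (fun s => X s ord0 j) t)).
by apply/funext => k; rewrite (eigenval_Q0P j) powR_half.
Qed.

Lemma Q0pow_Nhalf m (X : cloop R m) t j :
  Q0pow (- 2^-1) X t ord0 j = P (fun s => X s ord0 j) t.
Proof.
apply: (etrans (fcalcE _ _ _ _ _)).
apply: (congr1 (fun phi => mult phi (fun s => X s ord0 j) t)).
by apply/funext => k; rewrite (eigenval_Q0P j) powRN powR_half.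
Qed.

Lemma mult_lcomb phi I m (f : I -> R -> C) (z : I -> 'rV[C]_m) t j :
  order1 phi -> (forall i, rapid (f i)) ->
  mult phi (fun s => lcomb f z s ord0 j) t =
  lcomb (fun i => mult phi (f i)) z t ord0 j.
Proof.
move=> hp rf.
have -> : (fun t => lcomb f z t ord0 j) = (fun t => \sum_i z i ord0 j * f i t).
  by apply/funext => s; rewrite lcombE.
rewrite mult_sum// => [|i]; last exact: rapidZ.
by rewrite lcombE; apply: eq_bigr => i _; rewrite multZ.
Qed.

Lemma Q0pow_half_lcomb I m (f : I -> R -> C) (z : I -> 'rV[C]_m) :
  (forall i, rapid (f i)) ->
  Q0pow 2^-1 (lcomb f z) = lcomb (fun i => Q (f i)) z.
Proof.
move=> rf; apply/funext => t; apply/rowP => j.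
by rewrite Q0pow_half (mult_lcomb _ _ _ (@order1_lam R)).
Qed.

Lemma Q0pow_Nhalf_lcomb I m (f : I -> R -> C) (z : I -> 'rV[C]_m) :
  (forall i, rapid (f i)) ->
  Q0pow (- 2^-1) (lcomb f z) = lcomb (fun i => P (f i)) z.
Proof.
move=> rf; apply/funext => t; apply/rowP => j.
by rewrite Q0pow_Nhalf (mult_lcomb _ _ _ (@order1_rlam R)).
Qed.

Lemma ad_lcomb I (U : cloop R n) (f : I -> R -> C) (z : I -> 'rV[C]_n) :
  ad E U (lcomb f z) =
  lcomb (fun (p : 'I_n * I) t => U t ord0 p.1 * f p.2 t)
    (fun p => z p.2 *m adC E p.1).
Proof.
apply/funext => t; rewrite /ad brCE /lcomb.
rewrite -(pair_bigA _ (fun l i => (U t ord0 l * f i t) *: (z i *m adC E l))) /=.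
apply: eq_bigr => l _; rewrite mulmx_suml scaler_sumr.
by apply: eq_bigr => i _; rewrite -scalemxAl scalerA.
Qed.

Definition rapid_loop m (U : cloop R m) :=
  forall j, rapid (fun t => U t ord0 j).

(** Each application multiplies the index set by ['I_n], one copy for the components of [U]. *)
Lemma theta0_lcomb I (U : cloop R n) (f : I -> R -> C) (z : I -> 'rV[C]_n) :
  rapid_loop U -> (forall i, rapid (f i)) ->
  theta0 E 2^-1 U (lcomb f z) =
  lcomb (fun p : 'I_n * I => stheta (fun t => U t ord0 p.1) (f p.2))
    (fun p => z p.2 *m adC E p.1).
Proof.
move=> rU rf; apply/funext => t; rewrite /theta0 (Q0pow_half_lcomb _ rf) !ad_lcomb.
rewrite Q0pow_Nhalf_lcomb => [|p]; last exact: rapid_uQ.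
have -> : (fun (p : 'I_n * I) s => Q0pow 2^-1 U s ord0 p.1 * f p.2 s) =
   (fun (p : 'I_n * I) s => Q (fun r => U r ord0 p.1) s * f p.2 s).
  by apply/funext => p; apply/funext => s; rewrite Q0pow_half.
rewrite Q0pow_Nhalf_lcomb => [|p]; last exact: rapid_Qu.
rewrite /lcomb -big_split -sumrB /= scaler_sumr; apply: eq_bigr => p _.
by rewrite -scalerDl -scalerBl scalerA.
Qed.

Lemma mode_lcomb k (y : 'rV[C]_n) :
  mode k y = lcomb (fun _ : unit => @expi R k) (fun=> y).
Proof.
by apply/funext => t; rewrite /lcomb big_const card_unit /= addr0.
Qed.

End ModeExpansion.

Lemma sum_pair_swap (A : nmodType) (I : finType) (F : I -> I -> A) :
  \sum_(p : I * I) F p.1 p.2 = \sum_(p : I * I) F p.2 p.1.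
Proof.
rewrite -(pair_bigA _ F) -(pair_bigA _ (fun i j => F j i)) /=.
exact: exchange_big.
Qed.

Lemma mxtrace_lcomb (A : comNzRingType) n (I : finType) (c : I -> A)
  (M : I -> 'M[A]_n) : \tr (\sum_i c i *: M i) = \sum_i c i * \tr (M i).
Proof.
by rewrite raddf_sum; apply: eq_bigr => i _; exact: mxtraceZ.
Qed.

Lemma mx_lcomb_entry (A : comNzRingType) n (I : finType) (c : I -> A)
  (M : I -> 'M[A]_n) i j : (\sum_p c p *: M p) i j = \sum_p c p * M p i j.
Proof. by rewrite summxE; apply: eq_bigr => p _; rewrite mxE. Qed.

(** * Diagonal blocks of the curvature and their traces *)

Section CurvatureTrace.
Variables (R : realType) (G : lieGroup R) (E : 'I_(lie_dim G) -> derivation G).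
Hypothesis hE : lie_basis E.
Local Notation n := (lie_dim G).
Local Notation C := (R[i]).

Lemma theta0_mode (U : cloop R n) k (y : 'rV[C]_n) : rapid_loop U ->
  theta0 E 2^-1 U (mode k y) =
  lcomb (fun i => stheta (fun t => U t ord0 i) (expi k)) (fun i => y *m adC E i).
Proof.
move=> rU; rewrite mode_lcomb theta0_lcomb// => [|_]; last exact: rapid_expi.
apply/funext => t; rewrite /lcomb.
rewrite -(pair_bigA _ (fun l (_ : unit) =>
  stheta (fun t => U t ord0 l) (expi k) t *: (y *m adC E l))) /=.
by apply: eq_bigr => i _; rewrite big_const card_unit /= addr0.
Qed.

Lemma derive_periodic (u : R -> R) : Defs.periodic u -> Defs.periodic ('D_1 u).
Proof.
move=> pu t; rewrite /derive pu.
have -> // : u \o shift (t + 2 * pi) = u \o shift t.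
by apply/funext => x /=; rewrite addrA pu.
Qed.

Lemma periodicCk_real m (u : R -> R) : Ck m setT u -> Defs.periodic u ->
  periodicCk m (fun t => (u t)%:C).
Proof.
elim: m u => [|m ih] u Cu pu.
all: have cu : ccont (fun t => (u t)%:C) by split=> t;
  [exact: (Ck_continuous Cu)|exact: cvg_cst].
all: have p0 : (u (2 * pi))%:C = (u 0)%:C by rewrite -(pu 0) add0r.
- by split.
- have [du Cdu] := Cu.2 1; split=> //; exists (fun t => ('D_1 u t)%:C).
    move=> t; split=> /=; last exact: is_derive_cst.
    exact: DeriveDef (du t I) erefl.
  exact: ih Cdu (derive_periodic pu).
Qed.

Lemma Lg_rapid (U : R -> 'rV[R]_n) : Lg U -> rapid_loop (complexify U).
Proof.
move=> [sU pU] j; apply: periodicCk_rapid => m.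
have -> : (fun t => complexify U t ord0 j) = (fun t => (U t ord0 j)%:C).
  by apply/funext => t; rewrite mxE.
apply: periodicCk_real => [|t]; last by rewrite pU.
exact: (Ck_rowP m U openT).1 (sU m) j.
Qed.

(** The pointwise bracket is bilinear in the coordinates, with the structure constants as
    coefficients. *)
Lemma Lg_br (U V : R -> 'rV[R]_n) : Lg U -> Lg V ->
  Lg (fun t => br E (U t) (V t)).
Proof.
move=> [sU pU] [sV pV]; split; last by move=> t; rewrite pU pV.
move=> k; apply/(Ck_rowP k _ openT) => l.
have -> : (fun t => br E (U t) (V t) ord0 l) =
  (fun t => \sum_j V t ord0 j * \sum_i U t ord0 i * adR E i j l).
  apply/funext => t; rewrite -(mul_adM hE) mxE; apply: eq_bigr => j _.
  by rewrite summxE; congr (_ * _); apply: eq_bigr => i _; rewrite mxE.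
have cU := (Ck_rowP k U openT).1 (sU k).
have cV := (Ck_rowP k V openT).1 (sV k).
apply: Ck_sum => [|j]; first exact: openT.
apply: CkM => //; first exact: openT.
apply: Ck_sum => [|i]; first exact: openT.
by apply: CkM => //; [exact: openT|exact: Ck_cst].
Qed.

Lemma LgP (a : R) (U V : R -> 'rV[R]_n) : Lg U -> Lg V ->
  Lg (fun t => a *: U t + V t).
Proof.
move=> [sU pU] [sV pV]; split; last by move=> t; rewrite pU pV.
move=> k; apply/(Ck_rowP k _ openT) => l.
have -> : (fun t => (a *: U t + V t) ord0 l) =
  (fun t => a * U t ord0 l + V t ord0 l).
  by apply/funext => t; rewrite !mxE.
apply: CkD; first exact: openT.
  by apply: CkZ; [exact: openT|exact: (Ck_rowP k U openT).1 (sU k) l].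
exact: (Ck_rowP k V openT).1 (sV k) l.
Qed.

Section Fixed.
Variables (g : R -> G) (U V : R -> 'rV[R]_n).
Hypotheses (LU : Lg U) (LV : Lg V).

Let W := fun t => br E (U t) (V t).
Let u i := fun t => complexify U t ord0 i.
Let v i := fun t => complexify V t ord0 i.
Let w i := fun t => complexify W t ord0 i.

Let ru i : rapid (u i). Proof. exact: Lg_rapid LU i. Qed.
Let rv i : rapid (v i). Proof. exact: Lg_rapid LV i. Qed.
Let rw i : rapid (w i). Proof. exact: Lg_rapid (Lg_br LU LV) i. Qed.

(** The k-th diagonal Fourier block of [Omega], acting on rows from the right; the composite of ad
    e_(p.1) after ad e_(p.2) therefore appears as [adC E p.2 *m adC E p.1]. *)
Definition Omega_diag k : 'M[C]_n :=
  \sum_(p : 'I_n * 'I_n) scurv k (u p.1) (v p.2) *: (adC E p.2 *m adC E p.1)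
  - \sum_(p : 'I_n * 'I_n) scurv k (v p.1) (u p.2) *: (adC E p.2 *m adC E p.1)
  - \sum_i fc (stheta (w i) (expi k)) k *: adC E i.

Lemma ccont_lcomb (I : finType) m (f : I -> R -> C) (z : I -> 'rV[C]_m) j :
  (forall i, ccont (f i)) -> ccont (fun t => lcomb f z t ord0 j).
Proof.
move=> cf.
have -> : (fun t => lcomb f z t ord0 j) = (fun t => \sum_i z i ord0 j * f i t).
  by apply/funext => t; rewrite lcombE.
by apply: ccont_sum => i; apply: ccontM => //; exact: ccont_cst.
Qed.

Lemma fcoefBB m (X Y Z : cloop R m) k :
  (forall j, ccont (fun t => X t ord0 j)) ->
  (forall j, ccont (fun t => Y t ord0 j)) ->
  (forall j, ccont (fun t => Z t ord0 j)) ->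
  fcoef (fun t => X t - Y t - Z t) k = fcoef X k - fcoef Y k - fcoef Z k.
Proof.
move=> cX cY cZ; apply/rowP => j.
have mxB (A B : 'rV[C]_m) : (A - B) ord0 j = A ord0 j - B ord0 j.
  by rewrite !mxE.
rewrite !mxB !fcoefE -(fcB _ (cX j) (cY j)) -(fcB _ (ccontB (cX j) (cY j)) (cZ j)).
by congr (fc _ k); apply/funext => t; rewrite !mxB.
Qed.

Lemma fcoef_Omega k (y : 'rV[C]_n) :
  fcoef (Omega E 2^-1 g U V (mode k y)) k = y *m Omega_diag k.
Proof.
have eW : ad E (complexify U) (complexify V) = complexify W.
  by apply/funext => t; exact: brC_real.
have rsv i : rapid (stheta (v i) (expi k)) by exact: rapid_stheta_expi.
have rsu i : rapid (stheta (u i) (expi k)) by exact: rapid_stheta_expi.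
rewrite /Omega eW (theta0_mode k y (Lg_rapid LU)) (theta0_mode k y (Lg_rapid LV)).
rewrite (theta0_mode k y (Lg_rapid (Lg_br LU LV))).
rewrite (theta0_lcomb _ _ (Lg_rapid LU) rsv) (theta0_lcomb _ _ (Lg_rapid LV) rsu).
have c1 (p : 'I_n * 'I_n) : ccont (stheta (u p.1) (stheta (v p.2) (expi k))).
  exact: ccont_stheta.
have c2 (p : 'I_n * 'I_n) : ccont (stheta (v p.1) (stheta (u p.2) (expi k))).
  exact: ccont_stheta.
have c3 i : ccont (stheta (w i) (expi k)).
  exact: rapid_ccont (rapid_stheta_expi k (rw i)).
have cc (I : finType) (f : I -> R -> C) (z : I -> 'rV[C]_n) :
    (forall i, ccont (f i)) -> forall j, ccont (fun t => lcomb f z t ord0 j).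
  by move=> cf j; exact: ccont_lcomb.
apply: (etrans (fcoefBB k (cc _ _ _ c1) (cc _ _ _ c2) (cc _ _ _ c3))).
pose sub (A B : 'rV[C]_n) := A - B.
apply: (etrans (congr2 sub (congr2 sub (fcoef_lcomb _ k c1) (fcoef_lcomb _ k c2))
  (fcoef_lcomb _ k c3))).
have mulB (A B D : 'M[C]_n) :
    y *m (A - B - D) = sub (sub (y *m A) (y *m B)) (y *m D).
  by rewrite !mulmxBr.
have muls (J : finType) (c : J -> C) (A : J -> 'M[C]_n) (z : J -> 'rV[C]_n) :
    (forall p, z p = y *m A p) ->
    \sum_p c p *: z p = y *m \sum_p c p *: A p.
  move=> hz; rewrite mulmx_sumr; apply: eq_bigr => p _.
  by rewrite -scalemxAr hz.
apply: (etrans _ (esym (mulB _ _ _))).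
apply: (congr2 sub (congr2 sub _ _) _); apply: muls => p.
- by rewrite mulmxA.
- by rewrite mulmxA.
- by [].
Qed.

Lemma tr_Omega_diag k : \tr (Omega_diag k) = \sum_(p : 'I_n * 'I_n)
  (scurv k (u p.1) (v p.2) - scurv k (v p.2) (u p.1))
    * \tr (adC E p.2 *m adC E p.1).
Proof.
(* By [fc_stheta_expi] the sum is a multiple of the mean of the trace of ad [U, V], which is zero at
   every point of the circle. *)
have e3 : \sum_i fc (stheta (w i) (expi k)) k * \tr (adC E i) = 0.
  transitivity ((1 - 2^-1 * (rlam R k)%:C) *
      fc (fun t => \sum_i \tr (adC E i) * w i t) 0).
    rewrite fc_sum => [|i]; last by apply: ccontM;
      [exact: ccont_cst|exact: rapid_ccont].
    rewrite mulr_sumr; apply: eq_bigr => i _.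
    rewrite (fc_stheta_expi k (rw i)) (fcZ _ _ (rapid_ccont (rw i))).
    by rewrite -mulrA; congr (_ * _); exact: mulrC.
  have -> : (fun t => \sum_i \tr (adC E i) * w i t) = (fun t => 0 * expi 0 t).
    apply/funext => t; rewrite mul0r -[RHS](trace_adC_br hE (U t) (V t)).
    by apply: eq_bigr => i _; rewrite mulrC /w mxE.
  by rewrite (fcZ _ _ (@ccont_expi R 0)) mul0r mulr0.
(* Exchanging the two indices and using cyclicity of the trace gives both products the same matrix
   coefficient. *)
have e2 : \sum_(p : 'I_n * 'I_n) scurv k (v p.1) (u p.2) *
      \tr (adC E p.2 *m adC E p.1) =
    \sum_(p : 'I_n * 'I_n) scurv k (v p.2) (u p.1) *
      \tr (adC E p.2 *m adC E p.1).
  apply: (etrans (sum_pair_swap (fun i l => scurv k (v i) (u l) *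
    \tr (adC E l *m adC E i)))).
  by apply: eq_bigr => p _; apply: (congr1 ( *%R _)); exact: mxtrace_mulC.
pose sub (a b : C) := a - b.
have trB (A B D : 'M[C]_n) : \tr (A - B - D) = sub (sub (\tr A) (\tr B)) (\tr D).
  by rewrite !raddfB.
apply: (etrans (trB _ _ _)).
apply: (etrans (congr2 sub (congr2 sub (mxtrace_lcomb _ _) (mxtrace_lcomb _ _))
  (mxtrace_lcomb _ _))).
apply: (etrans (congr2 sub (congr2 sub erefl e2) e3)).
apply: (etrans (subr0 _)); apply: (etrans (esym (sumrB _ _ _ _))).
by apply: eq_bigr => p _; exact: (esym (mulrBl _ _ _)).
Qed.

(** Reversing the frequency exchanges [u] and [v] in [scurv], so the antisymmetrized coefficients of
    [tr_Omega_diag] change sign. *)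
Lemma tr_Omega_diagN k : \tr (Omega_diag (- k)) = - \tr (Omega_diag k).
Proof.
apply: (etrans (tr_Omega_diag _)).
apply: (etrans _ (congr1 -%R (esym (tr_Omega_diag _)))).
apply: (etrans _ (sumrN _ _ _)); apply: eq_bigr => p _.
have e1 := scurv_swap k (ru p.1) (rv p.2).
have e2 := scurv_swap k (rv p.2) (ru p.1).
apply: (etrans _ (mulNr _ _)); apply: (congr2 *%R _ erefl).
apply: (etrans (congr2 (fun a b => a - b) e1 e2)).
exact: (esym (opprB _ _)).
Qed.

Definition poly_growth (a : int -> C) :=
  exists K, forall k, cabs (a k) <= K * lam R k ^+ 7.

Lemma poly_growthD a b : poly_growth a -> poly_growth b ->
  poly_growth (fun k => a k + b k).
Proof.
move=> [A hA] [B hB]; exists (A + B) => k.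
by rewrite mulrDl (le_trans (cabsD _ _))// lerD.
Qed.

Lemma poly_growthB a b : poly_growth a -> poly_growth b ->
  poly_growth (fun k => a k - b k).
Proof.
move=> ga [B hB]; apply: poly_growthD => //.
by exists B => k; rewrite cabsN.
Qed.

Lemma poly_growthZ c a : poly_growth a -> poly_growth (fun k => a k * c).
Proof.
move=> [A hA]; exists (cabs c * A) => k.
by rewrite cabsM mulrC -mulrA ler_wpM2l ?cabs_ge0.
Qed.

Lemma poly_growth_sum (I : Type) (s : seq I) (F : I -> int -> C) :
  (forall i, poly_growth (F i)) -> poly_growth (fun k => \sum_(i <- s) F i k).
Proof.
move=> h; elim: s => [|i s ih].
  by exists 0 => k; rewrite big_nil cabs0 mul0r.
have [K hK] := poly_growthD (h i) ih.
by exists K => k; rewrite big_cons.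
Qed.

Lemma poly_growth_Omega_diag i j : poly_growth (fun k => Omega_diag k i j).
Proof.
have s1 : poly_growth (fun k => \sum_(p : 'I_n * 'I_n)
    scurv k (u p.1) (v p.2) * (adC E p.2 *m adC E p.1) i j).
  apply: poly_growth_sum => p; apply: poly_growthZ.
  exact: scurv_bound (ru p.1) (rv p.2).
have s2 : poly_growth (fun k => \sum_(p : 'I_n * 'I_n)
    scurv k (v p.1) (u p.2) * (adC E p.2 *m adC E p.1) i j).
  apply: poly_growth_sum => p; apply: poly_growthZ.
  exact: scurv_bound (rv p.1) (ru p.2).
have s3 : poly_growth (fun k => \sum_l
    fc (stheta (w l) (expi k)) k * adC E l i j).
  apply: poly_growth_sum => l; apply: poly_growthZ.
  exists (2 * cabs (fc (w l) 0)) => k; rewrite (fc_stheta_expi k (rw l)) cabsM.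
  have l1 := lam_ge1 R k.
  have h1 : cabs (1 - 2^-1 * (rlam R k)%:C) <= 2.
    have h2 : 2^-1 = (2^-1)%:C :> C.
      by rewrite -[2 in LHS](rmorph_nat (real_complex R)) -fmorphV.
    have -> : 1 - 2^-1 * (rlam R k)%:C = (1 - 2^-1 * rlam R k)%:C :> C.
      by rewrite rmorphB rmorphM h2 rmorph1.
    have r0 : 0 <= rlam R k by rewrite invr_ge0 ltW// lam_gt0.
    have r1 : rlam R k <= 1 by rewrite invf_le1 ?lam_gt0// lam_ge1.
    rewrite cabs_real ger0_norm; lra.
  rewrite -[leLHS]mulr1; apply: ler_pM; rewrite ?mulr_ge0 ?cabs_ge0//.
    by rewrite ler_wpM2r ?cabs_ge0.
  by rewrite exprn_ege1.
have entB (A B D : 'M[C]_n) : (A - B - D) i j = A i j - B i j - D i j.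
  by rewrite !mxE.
have [K hK] := poly_growthB (poly_growthB s1 s2) s3; exists K => k.
pose sub (a b : C) := a - b.
have -> : Omega_diag k i j = sub (sub
    (\sum_(p : 'I_n * 'I_n) scurv k (u p.1) (v p.2) * (adC E p.2 *m adC E p.1) i j)
    (\sum_(p : 'I_n * 'I_n) scurv k (v p.1) (u p.2) * (adC E p.2 *m adC E p.1) i j))
    (\sum_l fc (stheta (w l) (expi k)) k * adC E l i j).
  apply: (etrans (entB _ _ _)).
  exact: (congr2 sub (congr2 sub (mx_lcomb_entry _ _ _ _) (mx_lcomb_entry _ _ _ _))
    (mx_lcomb_entry _ _ _ _)).
exact: hK.
Qed.

End Fixed.
End CurvatureTrace.

(** * Heat-regularized traces and their finite part *)

Section FinitePart.
Variable R : realType.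

(** Convergence to 0 at 0+, in a form visibly stable under the dilation [x -> 2 * x]. *)
Definition vanishes (f : R -> R) := forall e, 0 < e ->
  exists2 d, 0 < d & forall x, 0 < x -> x < d -> `|f x| <= e.

Lemma cvg_right0_vanishes (f : R -> R) (l : R) :
  f x @[x --> 0^'+] --> l -> vanishes (fun x => l - f x).
Proof.
move=> /cvgrPdist_le h e /h /nbhs_ballP[d /= d0 hd]; exists d => // x x0 xd.
by apply: hd => //; rewrite /ball /= sub0r normrN gtr0_norm.
Qed.

Lemma vanishes_dilate (f : R -> R) : vanishes f -> vanishes (fun x => f (2 * x)).
Proof.
move=> h e /h[d d0 hd]; exists (d / 2); first by rewrite divr_gt0.
by move=> x x0 xd; apply: hd; lra.
Qed.

Lemma vanishesD (f g : R -> R) : vanishes f -> vanishes g ->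
  vanishes (fun x => f x + g x).
Proof.
move=> hf hg e e0; have e2 : 0 < e / 2 by rewrite divr_gt0.
have [d1 d10 h1] := hf _ e2; have [d2 d20 h2] := hg _ e2.
exists (Num.min d1 d2); first by rewrite lt_min d10.
move=> x x0; rewrite lt_min => /andP[x1 x2]; rewrite (le_trans (ler_normD _ _))//.
by rewrite [leRHS](splitr e) lerD ?h1 ?h2.
Qed.

Lemma vanishesZ (c : R) (f : R -> R) : vanishes f -> vanishes (fun x => c * f x).
Proof.
move=> h e e0; have c0 : 0 < `|c| + 1 by rewrite ltr_wpDl.
have [d d0 hd] := h _ (divr_gt0 e0 c0); exists d => // x x0 xd.
have := hd x x0 xd; rewrite ler_pdivlMr// normrM mulrC => /(le_trans _); apply.
by rewrite ler_wpM2r// lerDl.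
Qed.

Lemma vanishes_cst (c : R) : vanishes (fun=> c) -> c = 0.
Proof.
move=> h; apply/eqP; rewrite -normr_le0; apply/ler_addgt0Pr => e /h[d d0 hd].
by rewrite add0r; apply: (hd (d / 2)); lra.
Qed.

Lemma eq_vanishes (f g : R -> R) : (forall x, 0 < x -> f x = g x) ->
  vanishes f -> vanishes g.
Proof.
move=> fg h e /h[d d0 hd]; exists d => // x x0 xd; rewrite -fg//; exact: hd.
Qed.

Lemma ln2_gt0 : 0 < ln 2 :> R.
Proof. by rewrite ln_gt0// ltr1n. Qed.

(** Comparing the values at [2 * x] and [x] isolates the constant [ln 2 * b], which must then be
    0. *)
Lemma log_vanishes (b d : R) : vanishes (fun x => ln x * b + d) ->
  b = 0 /\ d = 0.
Proof.
move=> h; have hv : vanishes (fun=> ln 2 * b).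
  have := vanishesD (vanishes_dilate h) (vanishesZ (-1) h).
  by apply: eq_vanishes => x x0; rewrite lnM ?posrE//; ring.
have b0 : b = 0.
  by apply/eqP; move/vanishes_cst/eqP: hv; rewrite mulf_eq0 gt_eqF ?ln2_gt0.
split=> //; apply: vanishes_cst; apply: eq_vanishes h => x x0.
by rewrite b0 mulr0 add0r.
Qed.

Lemma powR2N_neq1 (a : R) : 0 < a -> 1 - 2 `^ (- a) != 0 :> R.
Proof.
move=> a0; rewrite subr_eq0; apply/eqP => /(congr1 (@ln R)).
rewrite ln1 ln_powR mulNr => /eqP; rewrite eq_sym oppr_eq0 mulf_eq0.
by rewrite !gt_eqF ?ln2_gt0.
Qed.

(* Passing from [f x] to [f (2 x) - 2^(-a) f x] removes the term in [x^(-a)]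
   without creating new ones. *)
Lemma power_log_vanishes (s : seq (R * R)) (b d : R) :
  all (fun p => 0 < p.1) s ->
  vanishes (fun x => \sum_(p <- s) x `^ (- p.1) * p.2 + (ln x * b + d)) ->
  b = 0 /\ d = 0.
Proof.
move: {2}(size s) (leqnn (size s)) => m.
elim: m s b d => [|m ih] [|[a c] s] // b d.
- by move=> _ _ h; apply: log_vanishes; apply: eq_vanishes h => x _;
    rewrite big_nil add0r.
- by move=> _ _ h; apply: log_vanishes; apply: eq_vanishes h => x _;
    rewrite big_nil add0r.
rewrite /= ltnS => sm /andP[a0 sp] h; set q := 2 `^ (- a).
have q1 : 1 - q != 0 by exact: powR2N_neq1.
(* Terms of [s] sharing the exponent [a] remain with coefficient 0, so repeated exponents are
   allowed. Dilating the logarithm adds [ln 2 * b] to the constant term. *)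
pose s' := [seq (p.1, (2 `^ (- p.1) - q) * p.2) | p <- s].
have [] := ih s' (b * (1 - q)) (d * (1 - q) + ln 2 * b).
- by rewrite size_map.
- by rewrite all_map.
- have := vanishesD (vanishes_dilate h) (vanishesZ (- q) h).
  apply: eq_vanishes => x x0; rewrite !big_cons /= lnM ?posrE//.
  have -> : \sum_(p <- s') x `^ (- p.1) * p.2 =
      \sum_(p <- s) (2 * x) `^ (- p.1) * p.2 - q * \sum_(p <- s) x `^ (- p.1) * p.2.
    rewrite big_map mulr_sumr -sumrB; apply: eq_bigr => p _ /=.
    by rewrite powRM ?(ltW x0)//; ring.
  by rewrite (powRM _ _ (ltW x0))// -/q; ring.
- move=> /eqP; rewrite mulf_eq0 (negbTE q1) orbF => /eqP -> /eqP.
  by rewrite mulr0 addr0 mulf_eq0 (negbTE q1) orbF => /eqP.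
Qed.

End FinitePart.

(** * Uniqueness of the finite part and Gaussian estimates *)

Section WeightedTrace.
Variables (R : realType) (m : nat).
Local Notation C := (R[i]).

Lemma Re_sum (I : Type) (s : seq I) (F : I -> C) :
  complex.Re (\sum_(i <- s) F i) = \sum_(i <- s) complex.Re (F i).
Proof. by elim/big_rec2: _ => // i x y _ <-; rewrite ReD. Qed.

Lemma Im_sum (I : Type) (s : seq I) (F : I -> C) :
  complex.Im (\sum_(i <- s) F i) = \sum_(i <- s) complex.Im (F i).
Proof. by elim/big_rec2: _ => // i x y _ <-; rewrite ImD. Qed.

(** If 0 is powers plus a logarithm plus [z] up to a vanishing term, then [power_log_vanishes],
    applied to the real and imaginary parts, forces [z = 0]. *)
Lemma finite_part0 (f : R -> C) (z : C) :
  (forall x, 0 < x -> f x = 0) -> finite_part f z -> z = 0.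
Proof.
move=> f0 [s [b [sp [hr hi]]]].
have [] := @power_log_vanishes R [seq (p.1, complex.Re p.2) | p <- s]
  (complex.Re b) (complex.Re z).
- by rewrite all_map.
- apply: eq_vanishes (cvg_right0_vanishes hr) => x x0.
  have hs : complex.Re (\sum_(p <- s) (x `^ (- p.1))%:C * p.2) =
      \sum_(p <- s) x `^ (- p.1) * complex.Re p.2.
    by rewrite Re_sum; apply: eq_bigr => p _; rewrite ReM mul0r subr0.
  have hb : complex.Re ((ln x)%:C * b) = ln x * complex.Re b.
    by rewrite ReM mul0r subr0.
  have h0 : complex.Re (0 : C) = 0 by [].
  by rewrite f0// !ReD !ReN hs hb h0 big_map /=; ring.
move=> _ z1.
have [] := @power_log_vanishes R [seq (p.1, complex.Im p.2) | p <- s]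
  (complex.Im b) (complex.Im z).
- by rewrite all_map.
- apply: eq_vanishes (cvg_right0_vanishes hi) => x x0.
  have hs : complex.Im (\sum_(p <- s) (x `^ (- p.1))%:C * p.2) =
      \sum_(p <- s) x `^ (- p.1) * complex.Im p.2.
    by rewrite Im_sum; apply: eq_bigr => p _; rewrite ImM mul0r addr0.
  have hb : complex.Im ((ln x)%:C * b) = ln x * complex.Im b.
    by rewrite ImM mul0r addr0.
  have h0 : complex.Im (0 : C) = 0 by [].
  by rewrite f0// !ImD !ImN hs hb h0 big_map /=; ring.
by move=> _ z2; rewrite [z]complex_eta z1 z2.
Qed.

Lemma finite_part_zero : finite_part (fun=> 0 : C) 0.
Proof.
exists [::], 0; split=> //.
have -> : (fun eps : R => (0 : C) - \sum_(p <- [::]) (eps `^ (- p.1))%:C * p.2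
    - (ln eps)%:C * 0) = (fun=> 0).
  by apply/funext => x; rewrite big_nil mulr0 !subr0.
by split; exact: cvg_cst.
Qed.

Lemma has_trace_eq0 (T : operator R m) (z : C) :
  (forall N, zsum N (fun k => \sum_j diag_entry T k j) = 0) ->
  has_trace T z -> z = 0.
Proof.
move=> T0 [_ hr hi]; rewrite [z]complex_eta.
have e F : (F \o fun N => zsum N (fun k => \sum_j diag_entry T k j)) =
    (fun=> F 0) :> (nat -> R) by apply/funext => N /=; rewrite T0.
have -> : complex.Re z = 0.
  by rewrite -(cvg_lim _ hr)// [X in lim (X @ _)](e (@complex.Re R)) lim_cst.
have -> : complex.Im z = 0.
  by rewrite -(cvg_lim _ hi)// [X in lim (X @ _)](e (@complex.Im R)) lim_cst.
by [].
Qed.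

Lemma zsum_odd (a : int -> C) N : (forall k, a (- k) = - a k) -> zsum N a = 0.
Proof.
move=> ha; have := zsum_opp N a.
rewrite (eq_zsum N ha) /zsum sumrN => /eqP.
by rewrite eq_sym -subr_eq0 opprK -mulr2n mulrn_eq0 => /eqP.
Qed.

(** The exponent 7 is that of [scurv_bound], and the weight costs 2 more. The fifth-order term of
    the exponential series supplies [lam k ^+ 10], hence [B]; the added 1 covers [k = 0]. *)
Lemma gauss_decay (eps : R) : 0 < eps -> exists2 D, 0 <= D &
  forall k, expR (- eps * k%:~R ^+ 2) * lam R k ^+ 7 <= D * wgt R k.
Proof.
move=> e0; pose B := (5`!%:R / eps ^+ 5 : R).
have B0 : 0 <= B by rewrite divr_ge0// exprn_ge0// ltW.
exists (B + 1) => [|k]; first by rewrite addr_ge0.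
have l0 := lam_gt0 R k; have l1 := lam_ge1 R k.
rewrite /wgt ler_pdivlMr ?exprn_gt0// -mulrA -exprD.
have [->|k0] := eqVneq k 0.
  by rewrite expr0n /= mulr0 expR0 mul1r lam0 expr1n lerDr.
have kl : k%:~R ^+ 2 = lam R k ^+ 2 :> R.
  by rewrite /lam (negbTE k0) real_normK ?num_real.
have h : (eps * lam R k ^+ 2) ^+ 5 / 5`!%:R <= expR (eps * lam R k ^+ 2).
  apply: le_trans (expR_ge1Dxn 4 _); last by rewrite mulr_ge0 ?exprn_ge0 ?ltW.
  by rewrite lerDr.
rewrite kl mulNr expRN mulrC ler_pdivrMr ?expR_gt0//.
apply: (@le_trans _ _ (lam R k ^+ 10)); first by rewrite ler_weXn2l.
apply: (@le_trans _ _ (B * expR (eps * lam R k ^+ 2))).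
  apply: le_trans (ler_wpM2l B0 h).
  by rewrite /B exprMn -exprM; rewrite le_eqVlt; apply/orP; left; apply/eqP;
    field; rewrite gt_eqF ?ltr0n ?fact_gt0//= gt_eqF.
by rewrite ler_wpM2r ?expR_ge0// lerDl.
Qed.

Lemma heat_mode (eps : R) k (y : 'rV[C]_m) : 0 < eps ->
  heat (@Q0 R m) eps (mode k y) = mode k ((expR (- eps * k%:~R ^+ 2))%:C *: y).
Proof.
move=> e0; apply/funext => t; apply/rowP => j.
pose phi (k : int) : R := expR (- eps * k%:~R ^+ 2).
(* The Gaussian symbol is at most 1, hence at most [lam], so the heat operator falls under the
   calculus of [mult]. *)
have o1 : order1 phi.
  move=> l; rewrite ger0_norm ?expR_ge0//; apply: le_trans (lam_ge1 R l).
  by rewrite -[leRHS]expR0 ler_expR mulNr oppr_le0 mulr_ge0 ?sqr_ge0// ltW.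
apply: (etrans (fcalcE _ _ _ _ _)).
have -> : (fun l => expR (- eps * eigenval (@Q0 R m) l)) = phi.
  by apply/funext => l; rewrite (eigenval_Q0 R j).
have -> : (fun s => mode k y s ord0 j) = (fun s => y ord0 j * expi k s).
  by apply/funext => s; exact: modeE.
rewrite (multZ _ _ o1 (rapid_expi R k)) mult_expi modeE mxE.
by rewrite mulrCA mulrA.
Qed.

End WeightedTrace.

(** * The Chern form vanishes *)

Section Vanishing.
Variables (R : realType) (G : lieGroup R) (E : 'I_(lie_dim G) -> derivation G).
Hypothesis hE : lie_basis E.
Local Notation n := (lie_dim G).
Local Notation C := (R[i]).

Section Fixed.
Variables (g : R -> G) (U V : R -> 'rV[R]_n).
Hypotheses (LU : Lg U) (LV : Lg V).

Let T (eps : R) := Omega E 2^-1 g U V \o heat (weight g) eps.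

Lemma diag_entry_Omega_heat eps k j : 0 < eps ->
  diag_entry (T eps) k j =
  (expR (- eps * k%:~R ^+ 2))%:C * Omega_diag E U V k j j.
Proof.
move=> e0; rewrite /diag_entry /T /= heat_mode// (fcoef_Omega hE g LU LV).
by rewrite -scalemxAl -rowE !mxE.
Qed.

(** The Gaussian weight is even in the frequency and the block trace odd, so every symmetric partial
    sum is 0 before any limit is taken. *)
Lemma zsum_trace_Omega_heat eps N : 0 < eps ->
  zsum N (fun k => \sum_j diag_entry (T eps) k j) = 0.
Proof.
move=> e0; apply: zsum_odd => k.
have tr l : \sum_j diag_entry (T eps) l j =
    (expR (- eps * l%:~R ^+ 2))%:C * \tr (Omega_diag E U V l).
  rewrite mulr_sumr; apply: eq_bigr => j _; exact: diag_entry_Omega_heat.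
apply: (etrans (tr (- k))); apply: (etrans _ (congr1 -%R (esym (tr k)))).
apply: (etrans _ (mulrN _ _)).
by apply: (congr2 *%R _ (tr_Omega_diagN hE LU LV k)); rewrite intrN sqrrN.
Qed.

(** The cancellation yields the value; the absolute bound demanded by [has_trace] comes from
    polynomial growth against the Gaussian. *)
Lemma has_trace_Omega_heat eps : 0 < eps -> has_trace (T eps) 0.
Proof.
move=> e0; have [D D0 hD] := gauss_decay e0.
have gr j := poly_growth_Omega_diag hE LU LV j j.
pose K j := projT1 (cid (gr j)).
have hK j k : cabs (Omega_diag E U V k j j) <= `|K j| * lam R k ^+ 7.
  rewrite (le_trans (projT2 (cid (gr j)) k))// ler_wpM2r ?ler_norm//.
  by rewrite exprn_ge0// ltW// lam_gt0.
split.
- exists (((\sum_j `|K j|) * D * wtot R)%:C) => N.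
  have -> : zsum N (fun k => \sum_j `|diag_entry (T eps) k j|) =
      (zsum N (fun k => \sum_j cabs (diag_entry (T eps) k j)))%:C.
    rewrite rmorph_sum; apply: eq_bigr => i _; rewrite rmorph_sum.
    by apply: eq_bigr => j _; exact: cabsE.
  rewrite lecR; apply: (@le_trans _ _ ((\sum_j `|K j|) * D * zsum N (wgt R))).
    rewrite -zsumZ; apply: le_zsum => k; rewrite -mulrA mulr_suml.
    apply: ler_sum => j _; rewrite diag_entry_Omega_heat// cabsM cabs_real.
    rewrite ger0_norm ?expR_ge0//.
    apply: le_trans (ler_wpM2l (normr_ge0 (K j)) (hD k)).
    by rewrite [leRHS]mulrCA; exact: (ler_wpM2l (expR_ge0 _) (hK j k)).
  by rewrite ler_wpM2l ?zsum_wgt_le_wtot// mulr_ge0// sumr_ge0.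
- have -> : (fun N => complex.Re (zsum N (fun k => \sum_j diag_entry (T eps) k j)))
    = (fun=> 0) by apply/funext => N; rewrite zsum_trace_Omega_heat.
  exact: cvg_cst.
- have -> : (fun N => complex.Im (zsum N (fun k => \sum_j diag_entry (T eps) k j)))
    = (fun=> 0) by apply/funext => N; rewrite zsum_trace_Omega_heat.
  exact: cvg_cst.
Qed.

Lemma is_wtrace_Omega : is_wtrace (weight g) (Omega E 2^-1 g U V) 0.
Proof.
exists (fun=> 0); split; first exact: has_trace_Omega_heat.
exact: finite_part_zero.
Qed.

(** Existence makes [xget] return a genuine weighted trace, and uniqueness of the finite part
    identifies it with 0. *)
Lemma chern1_eq0 : chern1 E 2^-1 g U V = 0.
Proof.
have [f [hf fp]] : is_wtrace (weight g) (Omega E 2^-1 g U V) (chern1 E 2^-1 g U V).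
  by apply: xgetPex; exists 0; exact: is_wtrace_Omega.
apply: finite_part0 fp => eps e0; apply: has_trace_eq0 (hf eps e0) => N.
exact: zsum_trace_Omega_heat.
Qed.

End Fixed.

Lemma dLG_chern1 g X U V : Lg U -> Lg V ->
  dLG E (fun h => chern1 E 2^-1 h U V) g X = 0.
Proof.
move=> LU LV; rewrite /dLG.
have -> : (fun t : R => complex.Re (chern1 E 2^-1
    (fun th => (g th * lie_exp E (t *: X th))%g) U V)) = cst 0.
  by apply/funext => t; rewrite chern1_eq0.
have -> : (fun t : R => complex.Im (chern1 E 2^-1
    (fun th => (g th * lie_exp E (t *: X th))%g) U V)) = cst 0.
  by apply/funext => t; rewrite chern1_eq0.
by rewrite derive1_cst.
Qed.

End Vanishing.

Theorem proposition3p5 (R : realType) (G : lieGroup R)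
    (E : 'I_(lie_dim G) -> derivation G) (hE : lie_basis E)
    (hss : semisimple E) (hct : compact_type E) :
  [/\ (forall g U V, LG g -> Lg U -> Lg V ->
         exists z, is_wtrace (weight g) (Omega E 2^-1 g U V) z),
      is_form2 (chern1 E 2^-1)
    & closed_form2 E (chern1 E 2^-1)].
Proof.
have c0 := chern1_eq0 hE; split.
- by move=> g U V _ LU LV; exists 0; exact: is_wtrace_Omega.
- split.
  + move=> g a X Y Z _ LX LY LZ; rewrite !c0//; last exact: LgP.
    by rewrite mulr0 addr0.
  + by move=> g X Y _ LX LY; rewrite !c0// oppr0.
  + move=> g X Y _ [LX _] [LY _]; split=> k.
    * have -> : (fun t : R => complex.Re (chern1 E 2^-1 (g t) (X t) (Y t))) =
        (fun=> 0) by apply/funext => t; rewrite c0.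
      exact: Ck_cst.
    * have -> : (fun t : R => complex.Im (chern1 E 2^-1 (g t) (X t) (Y t))) =
        (fun=> 0) by apply/funext => t; rewrite c0.
      exact: Ck_cst.
(* The six terms of [dform2] vanish one by one: three are derivatives of zero functions, three are
   values on a pair containing a bracket loop, smooth by [Lg_br]. *)
- move=> g X Y Z _ LX LY LZ.
  have sum0 (a b c d e f : R[i]) : a = 0 -> b = 0 -> c = 0 -> d = 0 -> e = 0 ->
      f = 0 -> a - b + c - d + e - f = 0.
    by move=> -> -> -> -> -> ->; rewrite !(subr0, addr0).
  have dc0 := dLG_chern1 hE g; have Lbr := Lg_br hE.
  exact: (sum0 _ _ _ _ _ _ (dc0 X Y Z LY LZ) (dc0 Y X Z LX LZ) (dc0 Z X Y LX LY)
    (c0 g _ _ (Lbr _ _ LX LY) LZ) (c0 g _ _ (Lbr _ _ LX LZ) LY)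
    (c0 g _ _ (Lbr _ _ LY LZ) LX)).
Qed.
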